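(* There is an absolute constant $C_*\geq 1$ with the following property. Let $\varepsilon\in(0,1)$ and $A>0$. For every real $Q\geq 3$, there exists a set $\mathcal{P}\subseteq[1,(\log Q)^{C_*(A+1)}]$ of primes, with $$|\mathcal{P}|\leq (\log Q)^{1+\varepsilon},$$ such that for all but $O_{\varepsilon,A}\bigl(Q(\log Q)^{-A}\bigr)$ positive integers $q\leq Q$ we have $$\left\{\prod_{p\in\mathcal{P}}p^{a_p}\bmod q\colon a_p\in\{0,1\}\text{ for each }p\in\mathcal{P}\right\}= (\mathbb{Z}/q\mathbb{Z})^\times .$$
   Context: The constant $C_*$ does not depend on $\varepsilon$, $A$ or $Q$. The notation $O_{\varepsilon,A}(\cdot)$ means that the implied constant depends only on $\varepsilon$ and $A$ (in particular not on $Q$). $|S|$ denotes the cardinality of a finite set $S$. The set $\mathcal{P}$ may depend on $Q,\varepsilon,A$ but not on $q$. The displayed set is the set of residues modulo $q$ of all products of subsets of $\mathcal{P}$ (the empty product being $1$). *)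

(* Defs.v *)
From mathcomp Require Import all_boot all_order all_algebra finmap.

Set Implicit Arguments.
Unset Strict Implicit.
Unset Printing Implicit Defensive.

Local Open Scope fset_scope.

(* Residues modulo q, for q > 0. The library's 'Z_q is not used because it
   denotes Z/2Z when q = 1, while 'I_q.-1.+1 with the operations Zp_add, Zp_mul
   of zmodp is Z/qZ for every q > 0, including the zero ring at q = 1. *)
Notation residues q := 'I_q.-1.+1.

Definition residue_units (q : nat) : {set residues q} :=
  [set x | [exists y : residues q, Zp_mul x y == Zp1]].

Definition subset_products_mod (P : {fset nat}) (q : nat) : {set residues q} :=
  [set inZp (\prod_(p : P) val p ^ a p)%N | a : {ffun P -> bool}].

Lemma residue_units_coprime (q : nat) (x : residues q) :
  0 < q -> (x \in residue_units q) = coprime q x.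
Proof.
case: q x => [//|n] x _; rewrite inE; apply/existsP/idP => [[y /eqP xy1]|cox].
  have e : x * y = 1 %[mod n.+1] by exact: (congr1 val xy1).
  have : coprime n.+1 (x * y) by rewrite -coprime_modr e coprime_modr coprimen1.
  by rewrite coprimeMr => /andP[].
by exists (Zp_inv x); apply/eqP; apply: Zp_mulzV.
Qed.

Lemma residue_units_Zp (n : nat) :
  residue_units n.+2 = [set x : 'Z_n.+2 | x \is a GRing.unit].
Proof.
apply/setP=> x; rewrite residue_units_coprime // inE.
by rewrite -[x in RHS]natr_Zp unitZpE.
Qed.

(* Main.v *)
Require Import Defs.
From mathcomp Require Import fingroup zmodp cyclic action separable.
From mathcomp Require Import algC cyclotomic classfun character.
From mathcomp Require Import all_boot all_order all_algebra finmap.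
From mathcomp Require Import all_classical all_reals all_analysis.
From mathcomp Require Import ring lra zify.
From mathcomp Require Import complex.

Set Implicit Arguments.
Unset Strict Implicit.
Unset Printing Implicit Defensive.

Import Order.TTheory GRing.Theory Num.Theory.
Local Open Scope fset_scope.
Local Open Scope ring_scope.

(** Write [L = ln Q], [z] for a large power of [L], [X = z ^ B] with [B] an
    absolute constant. The number of subsets of [P] with product congruent to
    [a] mod [q] is the average over the characters [chi] mod [q] of
    [(chi a)^* * \prod_(p in P) (1 + chi p)], and
    [|1 + chi p| ^ 2 / 4 = 1 - (1 - Re (chi p)) / 2]. So it suffices that
    [\sum_(p in P) (1 - Re (chi p))] exceeds a multiple of [L] for every
    nonprincipal [chi]. Choosing each prime [p] in [(z, X]] with probability
    [T / p], this holds for all [chi] simultaneously as soon as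
    [H(chi) = \sum_(z < p <= X) (1 - Re (chi p)) / p >= c0], where [1 / c0] is
    of order [ln X]. It remains to show that few [q] have a bad character,
    i.e. one with [H(chi) < c0].

    - A modulus [d <= z] has none: Selberg's sieve weight, multiplied by
      [1 - #{p <= z : p | n}], is orthogonal to [chi] and gives many [z]-rough
      [n <= X] with [chi n <> 1]; such [n] have at most [B] prime factors. This
      replaces any information on exceptional zeros.
    - For larger moduli, a large sieve by duality (only the trivial bound for
      complete sums is used) applied to the [k]-th power of
      [\sum_(z < p <= X) chi p], with [X ^ k] of size [D ^ 3], shows that at
      most [D ^ (1/4)] moduli up to [D] carry a bad character not induced from
      a bad character of a proper divisor. Two such characters of different
      moduli [d], [d'] are inequivalent, since otherwise both would come from a
      bad character mod [gcd d d']. Every bad [q] is a multiple of one of these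
      moduli. *)

(** * Mean values of products over primes, and squarefree numbers *)

(** The product expands over squarefree [k] with all prime factors in [s], and each [k] costs [Del]
    times the product of the [|gam p|] over [p] dividing [k]. The induction splits off one prime [p]
    and uses [v] a second time, restricted to the multiples of [p] and with [Y / p] for [Y]; the
    remaining [k] are prime to [p], so [p * k] divides [n] exactly when both factors do. *)
Lemma mean_euler_product (R : realType) (s l : seq nat) (v gam : nat -> R)
    (Y Del : R) :
  uniq s -> all prime s ->
  (forall k : nat, (0 < k)%N -> all (mem s) (primes k) ->
     `|\sum_(n <- l) v n * (k %| n)%:R - Y / k%:R| <= Del) ->
  `|\sum_(n <- l) v n * \prod_(p <- s) (1 + gam p * (p %| n)%:R)
     - Y * \prod_(p <- s) (1 + gam p / p%:R)|
  <= Del * \prod_(p <- s) (1 + `|gam p|).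
Proof.
elim: s v Y => [|p s IH] v Y /=.
  move=> _ _ /(_ 1%N isT isT); rewrite !big_nil !mulr1 divr1.
  congr (`|_ - Y| <= Del); apply: eq_bigr => n _.
  by rewrite dvd1n big_nil.
case/andP=> pNs us /andP[pp ps] reg.
have p0 : p%:R != 0 :> R by rewrite pnatr_eq0 -lt0n prime_gt0.
have IH1 := IH v Y us ps; have IH2 := IH (fun n => v n * (p %| n)%:R) (Y / p%:R) us ps.
have {IH1} h1 := IH1 _; have {IH2} h2 := IH2 _.
have {}h1 : `|\sum_(n <- l) v n * \prod_(p <- s) (1 + gam p * (p %| n)%:R)
     - Y * \prod_(p <- s) (1 + gam p / p%:R)| <= Del * \prod_(p <- s) (1 + `|gam p|).
  apply: h1 => k k0 hk; apply: reg => //.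
  by apply/allP => q /(allP hk); rewrite inE => /= qs; rewrite inE qs orbT.
have {}h2 : `|\sum_(n <- l) v n * (p %| n)%:R * \prod_(p <- s) (1 + gam p * (p %| n)%:R)
     - Y / p%:R * \prod_(p <- s) (1 + gam p / p%:R)| <= Del * \prod_(p <- s) (1 + `|gam p|).
  apply: h2 => k k0 hk.
  have pk : coprime p k.
    rewrite prime_coprime //; apply: contra pNs => pk.
    by apply: (allP hk); rewrite mem_primes pp k0.
  have := reg (p * k)%N; rewrite muln_gt0 prime_gt0 // k0 => /(_ isT) H.
  have {H} := H _; rewrite natrM invfM mulrA.
  have e : \sum_(n <- l) v n * (p * k %| n)%:R = \sum_(n <- l) v n * (p %| n)%:R * (k %| n)%:R.
    by apply: eq_bigr => n _; rewrite Gauss_dvd // -mulrA -natrM mulnb.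
  rewrite e; apply; apply/allP => q; rewrite mem_primes => /and3P[pq _].
  rewrite Euclid_dvdM // dvdn_prime2 // => /orP[/eqP->|qk]; first by rewrite /= inE eqxx.
  by rewrite /= inE; apply/orP; right; apply: (allP hk); rewrite mem_primes pq k0.
rewrite big_cons [X in Del * X]big_cons.
set S := \prod_(j <- s) (1 + gam j / _) in h1 h2 *.
set E := \prod_(j <- s) (1 + `|_|) in h1 h2 *.
have -> : \sum_(n <- l) v n * \prod_(q <- p :: s) (1 + gam q * (q %| n)%:R) =
  \sum_(n <- l) v n * \prod_(q <- s) (1 + gam q * (q %| n)%:R) +
  gam p * \sum_(n <- l) v n * (p %| n)%:R * \prod_(q <- s) (1 + gam q * (q %| n)%:R).
  rewrite mulr_sumr -big_split /=; apply: eq_bigr => n _.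
  by rewrite big_cons; ring.
set A := \sum_(n <- l) _ in h1 *; set B := \sum_(n <- l) _ in h2 *.
have -> : A + gam p * B - Y * ((1 + gam p / p%:R) * S) =
  (A - Y * S) + gam p * (B - Y / p%:R * S) by field.
rewrite (le_trans (ler_normD _ _)) // normrM mulrDl mul1r mulrDr lerD //.
by rewrite mulrCA ler_wpM2l.
Qed.

Lemma prod_sub_uniq (R : comNzRingType) (t u : seq nat) (F : nat -> R) :
  uniq t -> uniq u -> {subset t <= u} ->
  \prod_(p <- t) F p = \prod_(p <- u) (if p \in t then F p else 1).
Proof.
move=> ut uu tu; rewrite -big_mkcond -[RHS]big_filter.
apply: perm_big; apply: uniq_perm => //; first exact: filter_uniq.
by move=> p; rewrite mem_filter; case: (boolP (p \in t)) => //= /tu ->.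
Qed.

Definition sqfree (n : nat) := (0 < n)%N && all (fun p => logn p n <= 1)%N (primes n).

Lemma sqfreeP (n : nat) :
  reflect ((0 < n)%N /\ forall p, (logn p n <= 1)%N) (sqfree n).
Proof.
apply: (iffP andP) => -[n0 h]; split=> //.
  move=> p; have [pn|] := boolP (p \in primes n); first exact: (allP h).
  by rewrite -logn_gt0 -leqNgt => /leq_trans; apply.
by apply/allP.
Qed.

Lemma sqfree_prod_primes (n : nat) : sqfree n -> (\prod_(p <- primes n) p)%N = n.
Proof.
move=> /sqfreeP[n0 h]; rewrite [in RHS](prod_prime_decomp n0) prime_decompE big_map /=.
rewrite !big_seq; apply: eq_bigr => p; rewrite -logn_gt0 => lp.
by have -> : logn p n = 1%N; [apply/eqP; rewrite eqn_leq h|rewrite expn1].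
Qed.

Lemma sqfreeMp (p m : nat) : prime p -> (0 < m)%N ->
  sqfree (p * m) = sqfree m && ~~ (p %| m)%N.
Proof.
move=> pp m0; have p0 := prime_gt0 pp.
apply/sqfreeP/andP => [[_ h]|[/sqfreeP[_ h] pm]].
  split.
    apply/sqfreeP; split=> // q; apply: leq_trans (h q).
    by rewrite lognM // leq_addl.
  apply/negP => pm; have := h p; rewrite lognM // logn_prime // eqxx.
  by rewrite ltnS leqNgt logn_gt0 mem_primes pp m0 pm.
rewrite muln_gt0 p0 m0; split=> // q; rewrite lognM // logn_prime //.
have [<-|_] := eqVneq p q; last by rewrite add0n.
by rewrite logn_coprime // prime_coprime.
Qed.

Lemma primes_Mp (p m : nat) : prime p -> (0 < m)%N -> ~~ (p %| m)%N ->
  perm_eq (primes (p * m)) (p :: primes m).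
Proof.
move=> pp m0 pm; apply: uniq_perm; first exact: primes_uniq.
  by rewrite /= primes_uniq mem_primes pp m0 pm.
by move=> q; rewrite primesM ?(prime_gt0 pp) // primes_prime // !inE.
Qed.

(** * Orthogonality of the functions [ramf] *)

Section Quadratic.
Variable R : realType.
Implicit Types (v c : nat -> R) (l : seq nat).

(* The Ramanujan sum [c_r(n)] up to the sign [mu(r)], for squarefree [r]. *)
Definition ramf (r n : nat) : R :=
  \prod_(p <- primes r) (1 - p%:R * (p %| n)%:R).

Definition phir (r : nat) : R := \prod_(p <- primes r) (p%:R - 1).

(** The mean factors over primes: the local factor is [p - 1] if [p] divides both moduli and [0] if
    it divides exactly one, so only [r = s] survives. *)
Lemma mean_ramf_pair (l : seq nat) (v : nat -> R) (Y Del : R) (h r s : nat) :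
  (forall k : nat, (0 < k)%N -> coprime h k ->
     `|\sum_(n <- l) v n * (k %| n)%:R - Y / k%:R| <= Del) ->
  (0 < h)%N -> sqfree r -> sqfree s -> coprime h r -> coprime h s ->
  `|\sum_(n <- l) v n * (ramf r n * ramf s n) - Y * (phir r *+ (r == s))|
   <= Del * (r%:R ^+ 2 * s%:R ^+ 2).
Proof.
move=> reg h0 sr ss hr hs.
have [r0 _] := sqfreeP _ sr; have [s0 _] := sqfreeP _ ss.
pose A p : R := p%:R * (p \in primes r)%:R; pose B p : R := p%:R * (p \in primes s)%:R.
pose gam p : R := (1 - A p) * (1 - B p) - 1.
pose u := primes (r * s).
have uu : uniq u := primes_uniq _.
have pu : all prime u by apply/allP => p; rewrite mem_primes => /andP[].
have ru : {subset primes r <= u} by move=> p; rewrite primesM // => ->.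
have su : {subset primes s <= u} by move=> p; rewrite primesM // => ->; rewrite orbT.
have Del0 : 0 <= Del by apply: le_trans (reg 1%N isT (coprimen1 _)).
have ubound p : p \in u -> 2 <= p%:R :> R.
  by move/(allP pu)/prime_gt1; rewrite (ler_nat _ 2).
have reg' k : (0 < k)%N -> all (mem u) (primes k) ->
     `|\sum_(n <- l) v n * (k %| n)%:R - Y / k%:R| <= Del.
  move=> k0 ku; apply: reg => //; rewrite coprime_has_primes //.
  apply/hasPn => q /(allP ku) /= qu.
  have : coprime h (r * s) by rewrite coprimeMr hr.
  rewrite coprime_has_primes ?muln_gt0 ?r0 //.
  by move/hasPn => /(_ q qu).
have := mean_euler_product gam uu pu reg'.
have -> : \sum_(n <- l) v n * \prod_(p <- u) (1 + gam p * (p %| n)%:R) =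
    \sum_(n <- l) v n * (ramf r n * ramf s n).
  apply: eq_bigr => n _; congr (_ * _); rewrite /ramf.
  rewrite (prod_sub_uniq _ _ _ ru) ?primes_uniq // (prod_sub_uniq _ _ _ su) ?primes_uniq //.
  rewrite -big_split /=; apply: eq_bigr => p _; rewrite /gam /A /B.
  by case: (p %| n)%N; case: (p \in primes r); case: (p \in primes s) => /=; ring.
have -> : \prod_(p <- u) (1 + gam p / p%:R) = phir r *+ (r == s).
  have [ers|rs] := eqVneq r s.
    rewrite mulr1n /phir (prod_sub_uniq _ _ _ ru) ?primes_uniq // !big_seq.
    apply: eq_bigr => p pu'; have p2 := ubound p pu'.
    have p0 : p%:R != 0 :> R by apply/eqP => e; move: p2; rewrite e; lra.
    move: (pu'); rewrite /u primesM // -ers orbb => pr.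
    by rewrite /gam /A /B -ers pr /= !mulr1; field.
  rewrite mulr0n.
  have [p [pu' hp]] : exists p, p \in u /\ (p \in primes r) != (p \in primes s).
    apply: contrapT => hn; case/eqP: rs.
    rewrite -(sqfree_prod_primes sr) -(sqfree_prod_primes ss).
    apply: perm_big; apply: uniq_perm; rewrite ?primes_uniq // => p.
    apply/eqP/negPn/negP => hp; apply: hn; exists p; split=> //.
    by rewrite /u primesM //; move: hp; case: (p \in primes r) => //=; case: (_ \in _).
  rewrite (bigD1_seq p) //=.
  have -> : 1 + gam p / p%:R = 0 :> R; last by rewrite mul0r.
  have p2 := ubound p pu'.
  have p0 : p%:R != 0 :> R by apply/eqP => e; move: p2; rewrite e; lra.
  rewrite /gam /A /B; move: hp.
  by case: (p \in primes r); case: (p \in primes s) => //= _; rewrite mulr1 mulr0; field.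
(* For the error, [1 + |gam p|] is [(p - 1) ^ 2] if [p] divides both [r] and [s], and
   [p + 1 <= p ^ 2] if it divides one. *)
move=> /le_trans; apply; rewrite ler_wpM2l //.
rewrite -[r in leRHS](sqfree_prod_primes sr) -[s in leRHS](sqfree_prod_primes ss).
rewrite !natr_prod (prod_sub_uniq _ _ _ ru) ?primes_uniq //.
rewrite (prod_sub_uniq _ _ _ su) ?primes_uniq // -!prodrXl -big_split /= !big_seq.
apply: ler_prod => p pu'; have p2 := ubound p pu'.
rewrite addr_ge0 //= /gam /A /B.
case: (p \in primes r); case: (p \in primes s) => //=;
  rewrite ?mulr1 ?mulr0 ?subr0 ?mulr1 ?mul1r ?subrr ?normr0 ?expr1n ?mulr1 ?mul1r.
- rewrite ger0_norm; first by nra.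
  by nra.
- by rewrite ler0_norm; nra.
- by rewrite ler0_norm; nra.
- by rewrite addr0.
Qed.

End Quadratic.

Section MeanSquare.
Variable R : realType.

(* [h] is 1 or a prime: in the second case only the moduli prime to it occur. *)
Lemma mean_square_ramf (l : seq nat) (v c : nat -> R) (Y Del : R) (h N : nat) :
  (forall k : nat, (0 < k)%N -> coprime h k ->
     `|\sum_(n <- l) v n * (k %| n)%:R - Y / k%:R| <= Del) ->
  (0 < h)%N -> (forall r, ~~ coprime h r -> c r = 0) ->
  `|\sum_(n <- l) v n * (\sum_(1 <= r < N.+1 | sqfree r) c r * ramf R r n) ^+ 2
     - Y * \sum_(1 <= r < N.+1 | sqfree r) c r ^+ 2 * phir R r|
  <= Del * (\sum_(1 <= r < N.+1 | sqfree r) `|c r| * r%:R ^+ 2) ^+ 2.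
Proof.
move=> reg h0 ch.
have -> : \sum_(n <- l) v n * (\sum_(1 <= r < N.+1 | sqfree r) c r * ramf R r n) ^+ 2 =
  \sum_(1 <= r < N.+1 | sqfree r) \sum_(1 <= s < N.+1 | sqfree s)
    c r * c s * \sum_(n <- l) v n * (ramf R r n * ramf R s n).
  under eq_bigr => n _ do rewrite expr2 big_distrlr /= mulr_sumr.
  rewrite exchange_big /=; apply: eq_bigr => r _.
  under eq_bigr => n _ do rewrite mulr_sumr.
  rewrite exchange_big /=; apply: eq_bigr => s _.
  by rewrite mulr_sumr; apply: eq_bigr => n _; ring.
have -> : Y * \sum_(1 <= r < N.+1 | sqfree r) c r ^+ 2 * phir R r =
  \sum_(1 <= r < N.+1 | sqfree r) \sum_(1 <= s < N.+1 | sqfree s)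
    c r * c s * (Y * (phir R r *+ (r == s))).
  rewrite mulr_sumr big_nat_cond [RHS]big_nat_cond; apply: eq_bigr => r /andP[hr sr].
  rewrite [RHS]big_mkcond (bigD1_seq r) ?iota_uniq ?mem_index_iota //= sr eqxx mulr1n.
  rewrite big1 ?addr0; first by ring.
  by move=> s sr'; rewrite eq_sym (negbTE sr') mulr0n !mulr0 if_same.
rewrite -sumrB (le_trans (ler_norm_sum _ _ _)) //.
rewrite expr2 big_distrlr /= mulr_sumr.
apply: ler_sum => r sr; rewrite -sumrB (le_trans (ler_norm_sum _ _ _)) //.
rewrite mulr_sumr; apply: ler_sum => s ss.
rewrite -mulrBr !normrM.
have [hr|/ch->] := boolP (coprime h r); last by rewrite normr0 !mul0r mulr0.
have [hs|/ch->] := boolP (coprime h s); last by rewrite normr0 !(mul0r, mulr0).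
have a0 : 0 <= `|c r| * `|c s| by rewrite mulr_ge0.
apply: le_trans (ler_wpM2l a0 (mean_ramf_pair reg h0 sr ss hr hs)) _.
by rewrite le_eqVlt; apply/orP; left; apply/eqP; ring.
Qed.
End MeanSquare.

(** * The sieve weight *)

Section SieveParts.
Variable R : realType.

Lemma sum_sqfree_Mp (F : nat -> R) (p N : nat) : prime p ->
  \sum_(1 <= r < N.+1 | sqfree r && (p %| r)%N) F r =
  \sum_(1 <= m < N.+1 | [&& sqfree m, ~~ (p %| m)%N & (p * m <= N)%N]) F (p * m)%N.
Proof.
move=> pp; have p0 := prime_gt0 pp.
rewrite -[LHS]big_filter -[RHS]big_filter.
rewrite -(big_map (muln p) xpredT F); apply: perm_big; apply: uniq_perm.
- exact/filter_uniq/iota_uniq.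
- rewrite map_inj_uniq; first exact/filter_uniq/iota_uniq.
  by move=> a b /eqP; rewrite eqn_pmul2l // => /eqP.
move=> r; rewrite mem_filter mem_index_iota; apply/idP/mapP.
  case/and3P=> /andP[sr pr] r0 rN.
  have [m er] : exists m, r = (p * m)%N by case/dvdnP: pr => m ->; exists m; rewrite mulnC.
  have m0 : (0 < m)%N by move: r0; rewrite er muln_gt0 => /andP[].
  exists m => //; rewrite mem_filter mem_index_iota m0 ltnS.
  move: sr; rewrite er sqfreeMp // => /andP[-> ->] /=.
  move: rN; rewrite er ltnS => h; rewrite h /=.
  by apply: leq_trans h; rewrite leq_pmull.
case=> m; rewrite mem_filter mem_index_iota => /andP[/and3P[sm pm mN] /andP[m0 _]] ->.
by rewrite sqfreeMp // sm pm dvdn_mulr // muln_gt0 p0 m0 ltnS mN.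
Qed.

Lemma ramf_Mp (p m n : nat) : prime p -> (0 < m)%N -> ~~ (p %| m)%N ->
  ramf R (p * m) n = (1 - p%:R * (p %| n)%:R) * ramf R m n.
Proof. by move=> pp m0 pm; rewrite /ramf (perm_big _ (primes_Mp pp m0 pm)) big_cons. Qed.

Lemma phir_ge0 r : 0 <= phir R r.
Proof.
rewrite /phir big_seq; apply: prodr_ge0 => p; rewrite mem_primes => /andP[/prime_gt0 p0 _].
by rewrite subr_ge0 ler1n.
Qed.

Lemma phir_le r : sqfree r -> phir R r <= r%:R.
Proof.
move=> sr; rewrite -[r in leRHS](sqfree_prod_primes sr) natr_prod /phir !big_seq.
apply: ler_prod => p; rewrite mem_primes => /andP[/prime_gt0 p0 _].
by rewrite subr_ge0 ler1n p0 /= lerBlDr lerDl.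
Qed.

(** The square of [selw] is a Selberg weight written in the orthogonal functions [ramf]. It is
    [sqfS N ^ 2] at every [n] without prime factors up to [N], while its mean over all [n] is
    [sqfG N], which is at most [sqfS N]. *)
Definition selw (N n : nat) : R := \sum_(1 <= r < N.+1 | sqfree r) r%:R^-1 * ramf R r n.

(* The coefficients of [selw N] restricted to the multiples of [p], see [selw_dvd]. *)
Definition selcp (N p r : nat) : R :=
  if (p %| r)%N then 0 else r%:R^-1 * (if (p * r <= N)%N then p%:R^-1 else 1).

(** When [p] divides [n], the term at [p * m] is [(1 - p) / (p * m)] times [ramf m n] and nearly
    cancels the term [1 / m] times [ramf m n]: the two leave [1 / (p * m)]. Without a partner
    [p * m <= N] the coefficient stays [1 / m]. *)
Lemma selw_dvd (N p n : nat) : prime p -> (p %| n)%N ->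
  selw N n = \sum_(1 <= r < N.+1 | sqfree r) selcp N p r * ramf R r n.
Proof.
move=> pp pn; have p0 : p%:R != 0 :> R by rewrite pnatr_eq0 -lt0n prime_gt0.
rewrite /selw (bigID (fun r => p %| r)%N) /= sum_sqfree_Mp //.
rewrite [RHS](bigID (fun r => p %| r)%N) /= [X in _ = X + _]big1 ?add0r; last first.
  by move=> r /andP[_ pr]; rewrite /selcp pr mul0r.
rewrite big_mkcond [X in _ + X]big_mkcond [RHS]big_mkcond -big_split /= !big_nat.
apply: eq_bigr => m /andP[m0 _].
have m0' : m%:R != 0 :> R by rewrite pnatr_eq0 -lt0n.
case: (boolP (sqfree m)) => sm /=; last by rewrite addr0.
case: (boolP (p %| m)%N) => pm /=; first by rewrite addr0.
rewrite /selcp (negbTE pm); case: ifP => _; last by rewrite add0r mulr1.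
by rewrite ramf_Mp // pn /= mulr1 natrM; field; rewrite p0.
Qed.

Lemma inv_le_ln (n : nat) : (0 < n)%N -> (n.+1%:R)^-1 <= ln (n.+1%:R) - ln n%:R :> R.
Proof.
move=> n0; have n0' : 0 < n%:R :> R by rewrite ltr0n.
rewrite -opprB lerNr -ln_div ?posrE ?ltr0n //.
have -> : n%:R / n.+1%:R = 1 + - (n.+1%:R)^-1 :> R.
  by rewrite -natr1; field; rewrite natr1 pnatr_eq0.
by rewrite le_ln1Dx // ltrN2 invf_lt1 ?ltr0n // ltr1n.
Qed.

Lemma ln_le_inv (n : nat) : (0 < n)%N -> ln (n.+1%:R) - ln n%:R <= (n%:R)^-1 :> R.
Proof.
move=> n0; have n0' : 0 < n%:R :> R by rewrite ltr0n.
rewrite -ln_div ?posrE ?ltr0n //.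
have -> : n.+1%:R / n%:R = 1 + (n%:R)^-1 :> R by rewrite -natr1; field; rewrite gt_eqF.
by rewrite le_ln1Dx // (lt_trans (ltrN10 _)) // invr_gt0.
Qed.

Lemma harmonic_le (m n : nat) : (0 < m <= n)%N ->
  \sum_(m.+1 <= r < n.+1) (r%:R)^-1 <= ln n%:R - ln m%:R :> R.
Proof.
case/andP=> m0; elim: n => [|n IH]; first by rewrite leqNgt m0.
rewrite leq_eqVlt => /orP[/eqP ->|]; first by rewrite big_geq // subrr.
rewrite ltnS => mn; rewrite big_nat_recr //=.
apply: le_trans (lerD (IH mn) (inv_le_ln (leq_trans m0 mn))) _.
by rewrite addrAC addrCA subrr addr0.
Qed.

Lemma harmonic_le1 (n : nat) : (0 < n)%N ->
  \sum_(1 <= r < n.+1) (r%:R)^-1 <= 1 + ln n%:R :> R.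
Proof.
move=> n0; rewrite big_ltn // invr1.
by rewrite lerD2l; have := @harmonic_le 1 n n0; rewrite ln1 subr0.
Qed.

Lemma harmonic_ge (n : nat) : ln n.+1%:R <= \sum_(1 <= r < n.+1) (r%:R)^-1 :> R.
Proof.
elim: n => [|n IH]; first by rewrite ln1 big_geq.
rewrite big_nat_recr //=; apply: le_trans (lerD IH (@ln_le_inv n.+1 isT)).
by rewrite addrCA subrr addr0.
Qed.

Lemma sum_inv_tail (p N : nat) : (0 < p <= N)%N ->
  \sum_(1 <= r < N.+1 | (N < p * r)%N) (r%:R)^-1 <= ln (2 * p%:R) :> R.
Proof.
case/andP=> p0 pN; set m := (N %/ p)%N.
have m0 : (0 < m)%N by rewrite divn_gt0.
have mN : (m <= N)%N by apply: leq_div.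
have -> : \sum_(1 <= r < N.+1 | (N < p * r)%N) (r%:R)^-1 = \sum_(m.+1 <= r < N.+1) (r%:R)^-1 :> R.
  rewrite (big_cat_nat (n := m.+1)) //= big_nat_cond big1 ?add0r.
    rewrite big_nat_cond [RHS]big_nat_cond; apply: eq_bigl => r.
    by case: (boolP (m < r < N.+1)%N) => //= /andP[]; rewrite ltn_divLR // mulnC.
  by move=> r /andP[/andP[_]]; rewrite ltnS leq_divRL // mulnC leqNgt => /negbTE ->.
apply: le_trans (harmonic_le _) _; first by rewrite m0.
have N0 : (0 < N)%N by apply: leq_trans pN.
rewrite -ln_div ?posrE ?ltr0n // ler_ln ?posrE ?mulr_gt0 ?divr_gt0 ?invr_gt0 ?ltr0n //.
rewrite ler_pdivrMr ?ltr0n // -!natrM ler_nat.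
by have := divn_eq N p; have := ltn_pmod N p0; rewrite -/m; nia.
Qed.

End SieveParts.

(** * Sums over squarefree numbers and over primes *)

Section SieveSums.
Variable R : realType.

Definition sqfS (N : nat) : R := \sum_(1 <= r < N.+1 | sqfree r) r%:R^-1.
Definition sqfG (N : nat) : R := \sum_(1 <= r < N.+1 | sqfree r) r%:R^-1 ^+ 2 * phir R r.

Lemma sum_primesE (F : nat -> R) (n N : nat) : (0 < n <= N)%N ->
  \sum_(p <- primes n) F p = \sum_(1 <= p < N.+1 | prime p) (p %| n)%:R * F p.
Proof.
case/andP=> n0 nN; rewrite -[RHS]big_filter.
rewrite [RHS](bigID (fun p => p %| n)%N) /= [X in _ = _ + X]big1 ?addr0; last first.
  by move=> p /negbTE ->; rewrite mul0r.
rewrite [RHS](eq_bigr F); last by move=> p ->; rewrite mul1r.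
rewrite -[RHS]big_filter; apply: perm_big; apply: uniq_perm.
- exact: primes_uniq.
- exact/filter_uniq/filter_uniq/iota_uniq.
move=> p; rewrite mem_primes !mem_filter mem_index_iota n0 /=.
case: (boolP (prime p)) => pp /=; last by rewrite andbF.
case: (boolP (p %| n)%N) => pn //=.
by rewrite prime_gt0 //= ltnS (leq_trans (dvdn_leq n0 pn)).
Qed.

Lemma sqfree_mul_square (n : nat) : (0 < n)%N -> exists r m, sqfree r /\ n = (r * m ^ 2)%N.
Proof.
elim/ltn_ind: n => n IH n0.
have [sn|] := boolP (sqfree n); first by exists n, 1%N; rewrite muln1.
rewrite /sqfree n0 /= => /allPn[p]; rewrite mem_primes => /and3P[pp _ _].
rewrite -ltnNge => lp.
have pd : (p ^ 2 %| n)%N by rewrite pfactor_dvdn.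
case/dvdnP: pd => k ek.
have p1 := prime_gt1 pp.
have k0 : (0 < k)%N by move: n0; rewrite ek muln_gt0 => /andP[].
have kn : (k < n)%N by rewrite ek ltn_Pmulr // -(exp1n 2) ltn_sqr.
have [r [m [sr em]]] := IH k kn k0.
exists r, (m * p)%N; split=> //; rewrite ek em expnMn; ring.
Qed.

Lemma sum_inv_sq (N : nat) : (0 < N)%N ->
  \sum_(1 <= m < N.+1) (m%:R ^+ 2)^-1 <= 2 - N%:R^-1 :> R.
Proof.
elim: N => // -[_ _|N IH _]; first by rewrite big_nat1 expr1n !invr1; lra.
rewrite big_nat_recr //=; apply: le_trans (lerD (IH isT) (lexx _)) _.
have a0 : 0 < N.+1%:R :> R by rewrite ltr0n.
have b0 : 0 < N.+2%:R :> R by rewrite ltr0n.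
have -> : N.+2%:R = N.+1%:R + 1 :> R by rewrite -natr1.
rewrite -addrA lerD2l -subr_ge0.
set x : R := N.+1%:R in a0 *.
have -> : - (x + 1)^-1 - (- x^-1 + ((x + 1) ^+ 2)^-1) = (x * (x + 1) ^+ 2)^-1.
  by field; rewrite !gt_eqF //; lra.
by rewrite invr_ge0 mulr_ge0 ?sqr_ge0 // ltW.
Qed.

(** Writing each [n <= N] as [r * m ^ 2] with [r] squarefree bounds the harmonic sum by [sqfS N]
    times the sum of [1 / m ^ 2], which is at most [2]. *)
Lemma sqfS_ge (N : nat) : (0 < N)%N -> ln N%:R <= 2 * sqfS N.
Proof.
move=> N0; apply: le_trans (_ : \sum_(1 <= n < N.+1) n%:R^-1 <= _).
  apply: le_trans (harmonic_ge _ _); rewrite ler_ln ?posrE ?ltr0n // ler_nat //.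
have h n : (0 < n < N.+1)%N -> n%:R^-1 <= \sum_(1 <= r < N.+1 | sqfree r)
    \sum_(1 <= m < N.+1) (r * m ^ 2 == n)%N%:R * (r%:R^-1 * (m%:R ^+ 2)^-1) :> R.
  case/andP=> n0 nN; have [r [m [sr em]]] := sqfree_mul_square n0.
  have := n0; rewrite em muln_gt0 expn_gt0 orbF => /andP[r0 m0].
  have rN : (0 < r < N.+1)%N.
    by rewrite r0 (leq_ltn_trans _ nN) // em leq_pmulr // expn_gt0 m0.
  have mN : (0 < m < N.+1)%N.
    rewrite m0 (leq_ltn_trans _ nN) // em (leq_trans _ (leq_pmull _ r0)) //.
    by rewrite -[leqLHS]expn1 leq_pexp2l.
  rewrite big_mkcond (bigD1_seq r) ?iota_uniq ?mem_index_iota //= sr.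
  rewrite (bigD1_seq m) ?iota_uniq ?mem_index_iota //= -em eqxx mul1r.
  rewrite [in leLHS]em natrM natrX invfM -addrA lerDl addr_ge0 //.
    by apply: sumr_ge0 => i _; rewrite !mulr_ge0 ?invr_ge0 ?exprn_ge0.
  apply: sumr_ge0 => i _; case: ifP => // _.
  by apply: sumr_ge0 => j _; rewrite !mulr_ge0 ?invr_ge0 ?exprn_ge0.
apply: (@le_trans _ _ (\sum_(1 <= n < N.+1) \sum_(1 <= r < N.+1 | sqfree r)
    \sum_(1 <= m < N.+1) (r * m ^ 2 == n)%N%:R * (r%:R^-1 * (m%:R ^+ 2)^-1))).
  by rewrite !big_nat; apply: ler_sum => n; apply: h.
rewrite exchange_big /= /sqfS mulrC mulr_suml; apply: ler_sum => r sr.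
rewrite exchange_big /=.
have : \sum_(1 <= m < N.+1) (m%:R ^+ 2)^-1 <= 2 :> R.
  by apply: le_trans (sum_inv_sq N0) _; rewrite gerBl invr_ge0.
have ri : 0 <= r%:R^-1 :> R by rewrite invr_ge0.
move/(ler_wpM2l ri); apply: le_trans; rewrite mulr_sumr; apply: ler_sum => m _.
rewrite -mulr_suml ler_piMl ?mulr_ge0 ?invr_ge0 ?exprn_ge0 //.
have [hn|hn] := boolP (0 < r * m ^ 2 < N.+1)%N.
  rewrite (bigD1_seq (r * m ^ 2)%N) ?iota_uniq ?mem_index_iota //= eqxx big1 ?addr0 //.
  by move=> i; rewrite eq_sym => /negbTE ->.
rewrite big_nat big1 // => i hi; case: eqP => // e; by move: hn; rewrite e hi.
Qed.

Lemma prod_1B_ge (s : seq nat) (x : nat -> R) : (forall i, i \in s -> 0 <= x i <= 1) ->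
  1 - \sum_(i <- s) x i <= \prod_(i <- s) (1 - x i).
Proof.
elim: s => [|a s IH] h; first by rewrite !big_nil subr0.
rewrite !big_cons; have /andP[a0 a1] := h a (mem_head _ _).
have h' i : i \in s -> 0 <= x i <= 1 by move=> si; apply: h; rewrite inE si orbT.
have := IH h'; set S := \sum_(_ <- _) _; set P := \prod_(_ <- _) _ => SP.
have S0 : 0 <= S by rewrite /S big_seq; apply: sumr_ge0 => i /h' /andP[].
by nra.
Qed.

Lemma sum_inv_sq2 (N : nat) : \sum_(2 <= p < N.+3) (p%:R ^+ 2)^-1 <= 3 / 4 - N.+2%:R^-1 :> R.
Proof.
elim: N => [|N IH]; first by rewrite big_nat1; lra.
rewrite big_nat_recr //=; apply: le_trans (lerD IH (lexx _)) _.
have a0 : 0 < N.+2%:R :> R by rewrite ltr0n.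
have -> : N.+3%:R = N.+2%:R + 1 :> R by rewrite -natr1.
rewrite -addrA lerD2l -subr_ge0.
set x : R := N.+2%:R in a0 *.
have -> : - (x + 1)^-1 - (- x^-1 + ((x + 1) ^+ 2)^-1) = (x * (x + 1) ^+ 2)^-1.
  by field; rewrite !gt_eqF //; lra.
by rewrite invr_ge0 mulr_ge0 ?sqr_ge0 // ltW.
Qed.

Lemma sum_prime_inv_sq (N : nat) :
  \sum_(1 <= p < N.+1 | prime p) (p%:R ^+ 2)^-1 <= 3 / 4 :> R.
Proof.
apply: le_trans (_ : \sum_(1 <= p < N.+3 | prime p) (p%:R ^+ 2)^-1 <= _).
  rewrite [leRHS](big_cat_nat (n := N.+1)) //= ?lerDl; last by lia.
  by apply: sumr_ge0 => p _; rewrite invr_ge0 exprn_ge0.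
rewrite big_ltn_cond //.
apply: le_trans (_ : \sum_(2 <= p < N.+3) (p%:R ^+ 2)^-1 <= _).
  rewrite big_mkcond; apply: ler_sum => p _.
  by case: ifP => // _; rewrite invr_ge0 exprn_ge0.
by apply: le_trans (sum_inv_sq2 N) _; rewrite gerBl invr_ge0.
Qed.

Lemma sqfS_ge0 (N : nat) : 0 <= sqfS N.
Proof. by apply: sumr_ge0 => r _; rewrite invr_ge0. Qed.

(** By [prod_1B_ge], [phir r / r] is at least [1] minus the sum of [1 / p] over [p] dividing [r].
    Exchanging sums, the subtracted part is at most [sqfS N] times the sum of [1 / p ^ 2]; that this
    sum is below [1], namely at most [3 / 4], is decisive. *)
Lemma sqfG_ge (N : nat) : sqfS N / 4 <= sqfG N.
Proof.
have h1 : sqfS N - \sum_(1 <= r < N.+1 | sqfree r) r%:R^-1 * (\sum_(p <- primes r) p%:R^-1) <= sqfG N.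
  rewrite /sqfS /sqfG -sumrB big_nat_cond [leRHS]big_nat_cond; apply: ler_sum => r /andP[/andP[r0 _] sr].
  have r0' : r%:R != 0 :> R by rewrite pnatr_eq0 -lt0n.
  rewrite -{1}[r%:R^-1]mulr1 -mulrBr expr2 -mulrA ler_wpM2l ?invr_ge0 //.
  have -> : r%:R^-1 * phir R r = \prod_(p <- primes r) (1 - p%:R^-1).
    rewrite -{1}(sqfree_prod_primes sr) natr_prod -prodfV -big_split /= !big_seq.
    apply: eq_bigr => p; rewrite mem_primes => /andP[/prime_gt0 p0 _].
    by rewrite mulrBr mulr1 mulVf // pnatr_eq0 -lt0n.
  apply: prod_1B_ge => p; rewrite mem_primes => /andP[/prime_gt0 p0 _].
  by rewrite invr_ge0 ler0n invf_le1 ?ltr0n // ler1n.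
have h2 : \sum_(1 <= r < N.+1 | sqfree r) r%:R^-1 * (\sum_(p <- primes r) p%:R^-1) <=
    \sum_(1 <= p < N.+1 | prime p) (p%:R ^+ 2)^-1 * sqfS N.
  have -> : \sum_(1 <= r < N.+1 | sqfree r) r%:R^-1 * (\sum_(p <- primes r) p%:R^-1) =
    \sum_(1 <= r < N.+1 | sqfree r) \sum_(1 <= p < N.+1 | prime p)
      r%:R^-1 * ((p %| r)%N%:R * p%:R^-1) :> R.
    rewrite big_nat_cond [RHS]big_nat_cond; apply: eq_bigr => r /andP[/andP[r0 rN] sr].
    by rewrite (@sum_primesE _ _ N) ?r0 // mulr_sumr.
  rewrite exchange_big /=; apply: ler_sum => p pp.
  have p0' : 0 < p%:R :> R by rewrite ltr0n prime_gt0.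
  have -> : \sum_(1 <= r < N.+1 | sqfree r) r%:R^-1 * ((p %| r)%N%:R * p%:R^-1) =
     \sum_(1 <= r < N.+1 | sqfree r && (p %| r)%N) r%:R^-1 * p%:R^-1 :> R.
    rewrite [RHS]big_mkcondr /=; apply: eq_bigr => r _.
    by case: (p %| r)%N; rewrite ?mul1r // mul0r mulr0.
  rewrite sum_sqfree_Mp // /sqfS mulr_sumr big_mkcond [leRHS]big_mkcond.
  apply: ler_sum => m _; case: (boolP (sqfree m)) => sm /=; last by [].
  rewrite natrM expr2 !invfM; case: ifP => _.
    by rewrite mulrAC.
  by rewrite !mulr_ge0 ?invr_ge0.
have h3 := @sum_prime_inv_sq N.
have h4 : \sum_(1 <= p < N.+1 | prime p) (p%:R ^+ 2)^-1 * sqfS N <= 3 / 4 * sqfS N.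
  by rewrite -mulr_suml ler_wpM2r // sqfS_ge0.
move: h1 h2 h4; set a := \sum_(1 <= r < N.+1 | _) _; set b := \sum_(1 <= r < N.+1 | _) _.
lra.
Qed.

(** Chebyshev's argument: the sum of [ln n] for [n <= z] is at least the sum of [(z %/ p) * ln p]
    over primes, and [z %/ p] is at least [z / (2 * p)]. *)
Lemma sum_ln_prime_div (z : nat) : (0 < z)%N ->
  \sum_(1 <= p < z.+1 | prime p) ln p%:R / p%:R <= 2 * ln z%:R :> R.
Proof.
move=> z0; have z0' : 0 < z%:R :> R by rewrite ltr0n.
have h1 : \sum_(1 <= n < z.+1) ln n%:R <= z%:R * ln z%:R :> R.
  have -> : z%:R * ln z%:R = \sum_(1 <= n < z.+1) ln z%:R :> R.
    by rewrite big_const_nat subn1 /= iter_addr_0 mulr_natl.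
  rewrite !big_nat; apply: ler_sum => n /andP[n0 nz].
  by rewrite ler_ln ?posrE ?ltr0n // ler_nat.
have h2 : \sum_(1 <= n < z.+1) \sum_(p <- primes n) ln p%:R <= \sum_(1 <= n < z.+1) ln n%:R :> R.
  rewrite !big_nat; apply: ler_sum => n /andP[n0 nz].
  have H : (\prod_(p <- primes n) p <= n)%N.
    rewrite [leqRHS](prod_prime_decomp n0) prime_decompE big_map /= !big_seq.
    apply: leq_prod => p; rewrite -logn_gt0 => lp; rewrite -[leqLHS]expn1.
    by rewrite leq_pexp2l // prime_gt0 //; move: lp; rewrite lognE; case: ifP => // /andP[].
  have P0 (s : seq nat) : all prime s ->
      \sum_(p <- s) ln p%:R = ln (\prod_(p <- s) p)%N%:R :> R /\ (0 < \prod_(p <- s) p)%N.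
    elim: s => [|p s IH] /=; first by rewrite !big_nil ln1.
    case/andP=> pp /IH[e g]; rewrite !big_cons e natrM lnM ?posrE ?ltr0n ?(prime_gt0 pp) ?g //.
    by rewrite muln_gt0 (prime_gt0 pp) g.
  have [|-> g] := P0 (primes n); first by apply/allP => p; rewrite mem_primes => /andP[].
  by rewrite ler_ln ?posrE ?ltr0n // ler_nat.
have h3 : \sum_(1 <= n < z.+1) \sum_(p <- primes n) ln p%:R =
    \sum_(1 <= p < z.+1 | prime p) (z %/ p)%:R * ln p%:R :> R.
  transitivity (\sum_(1 <= n < z.+1) \sum_(1 <= p < z.+1 | prime p) (p %| n)%N%:R * ln p%:R : R).
    by rewrite !big_nat; apply: eq_bigr => n /andP[n0 nz]; rewrite (@sum_primesE _ _ z) ?n0.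
  rewrite exchange_big /=; apply: eq_bigr => p pp.
  by rewrite -mulr_suml -natr_sum -divn_count_dvd.
have h4 : z%:R / 2 * \sum_(1 <= p < z.+1 | prime p) ln p%:R / p%:R <=
    \sum_(1 <= p < z.+1 | prime p) (z %/ p)%:R * ln p%:R :> R.
  rewrite mulr_sumr big_nat_cond [leRHS]big_nat_cond; apply: ler_sum => p /andP[/andP[p0 pz] pp].
  have p0' : 0 < p%:R :> R by rewrite ltr0n.
  have -> : z%:R / 2 * (ln p%:R / p%:R) = (z%:R / (2 * p%:R)) * ln p%:R :> R.
    by field; rewrite gt_eqF.
  rewrite ler_wpM2r ?ln_ge0 ?ler1n // ler_pdivrMr ?mulr_gt0 //.
  rewrite -!natrM ler_nat.
  have d1 : (0 < z %/ p)%N by rewrite divn_gt0.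
  by have := divn_eq z p; have := ltn_pmod z p0; nia.
have h5 : z%:R / 2 * \sum_(1 <= p < z.+1 | prime p) ln p%:R / p%:R <= z%:R / 2 * (2 * ln z%:R) :> R.
  apply: le_trans h4 _; rewrite -h3; apply: le_trans h2 _; apply: le_trans h1 _.
  by rewrite le_eqVlt; apply/orP; left; apply/eqP; field.
by move: h5; rewrite ler_pM2l // divr_gt0.
Qed.

End SieveSums.

(** * Lower bound for sums over rough numbers *)

Section Sieve.
Variable R : realType.

Definition rough (z n : nat) := all (fun p => z < p)%N (primes n).

(** Each prime [q] of [s] at most doubles the sum: in a term [r = q * m] the weight [q] cancels the
    factor [1 / q], leaving the term of [m]. This serves to bound [selw] at an [n] with few prime
    factors. *)
Lemma sum_sqfree_weighted (s : seq nat) (N : nat) : uniq s -> all prime s ->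
  \sum_(1 <= r < N.+1 | sqfree r)
     r%:R^-1 * \prod_(p <- primes r) (if p \in s then p%:R else 1) <= 2 ^+ size s * sqfS R N.
Proof.
elim: s => [|q s IH] /=.
  move=> _ _; rewrite expr0 mul1r; apply: ler_sum => r _.
  by rewrite big1 ?mulr1 // => p _.
case/andP=> qs us /andP[qp sp].
have := IH us sp; rewrite exprS -mulrA.
set t := fun r : nat => \prod_(p <- primes r) (if p \in s then p%:R else 1 : R).
set t' := fun r : nat => \prod_(p <- primes r) (if p \in q :: s then p%:R else 1 : R).
rewrite -/t => h.
have t0 r : 0 <= t r by apply: prodr_ge0 => p _; case: ifP.
have tE r : ~~ (q %| r)%N -> t' r = t r.
  move=> qr; rewrite /t /t' !big_seq; apply: eq_bigr => p.
  rewrite mem_primes inE => /and3P[_ _ pr].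
  by case: eqP => // e; move: qr; rewrite -e pr.
rewrite (bigID (fun r => q %| r)%N) /= sum_sqfree_Mp //.
apply: le_trans (_ : 2 * \sum_(1 <= r < N.+1 | sqfree r) r%:R^-1 * t r <= _); last first.
  by rewrite ler_wpM2l.
rewrite mulr2n mulrDl mul1r lerD // big_mkcond [leRHS]big_mkcond /= !big_nat; apply: ler_sum => m /andP[m0 _].
  case: (boolP (sqfree m)) => //= sm.
  case: ifP => [/andP[qm _]|_]; last by rewrite mulr_ge0 ?invr_ge0.
  rewrite (perm_big _ (primes_Mp qp m0 qm)) big_cons -/(t' m) tE // inE eqxx /=.
  suff -> : (q * m)%:R^-1 * (q%:R * t m) = m%:R^-1 * t m by [].
  rewrite natrM; field; rewrite !pnatr_eq0 -!lt0n m0 /=.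
  exact: prime_gt0.
case: (boolP (sqfree m)) => //= sm.
case: ifP => [qm|_]; last by rewrite mulr_ge0 ?invr_ge0.
by rewrite -/(t' m) tE.
Qed.

Lemma selw_norm_le (N n : nat) : (0 < n)%N ->
  `|selw R N n| <= 2 ^+ size (primes n) * sqfS R N.
Proof.
move=> n0; apply: le_trans (sum_sqfree_weighted N (primes_uniq n) _); last first.
  by apply/allP => p; rewrite mem_primes => /andP[].
apply: le_trans (ler_norm_sum _ _ _) _; apply: ler_sum => r _.
rewrite normrM ger0_norm ?invr_ge0 // ler_wpM2l ?invr_ge0 //.
rewrite /ramf normr_prod !big_seq; apply: ler_prod => p; rewrite mem_primes => /andP[pp _].
rewrite normr_ge0 mem_primes pp n0 /=.
have p1 : 1 <= p%:R :> R by rewrite ler1n prime_gt0.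
case: (p %| n)%N => /=; last by rewrite mulr0 subr0 normr1.
by rewrite mulr1 ler0_norm; lra.
Qed.

Lemma rough_size (z n B : nat) : (1 < z)%N -> rough z n -> (0 < n <= z ^ B)%N ->
  (size (primes n) <= B)%N.
Proof.
move=> z1 rn /andP[n0 nX].
rewrite -(leq_exp2l _ _ z1); apply: leq_trans nX.
rewrite [leqRHS](prod_prime_decomp n0) prime_decompE big_map /=.
have h : all (fun p => z < p)%N (primes n) -> all (fun p => 0 < logn p n)%N (primes n) ->
    (z ^ size (primes n) <= \prod_(p <- primes n) p ^ logn p n)%N.
  elim: (primes n) => [|p s IH] /=; first by rewrite big_nil.
  case/andP=> zp zs /andP[lp ls]; rewrite big_cons expnS leq_mul ?IH //.
  by rewrite (leq_trans (ltnW zp)) // -[leqLHS]expn1 leq_pexp2l // (leq_trans _ zp).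
by apply: h => //; apply/allP => p; rewrite logn_gt0.
Qed.

Section Mass.
Variables (v : nat -> R) (X N : nat) (Del : R).
Hypothesis v0 : forall n, 0 <= v n.
Hypothesis reg : forall k : nat, (0 < k)%N ->
  `|\sum_(1 <= n < X.+1) v n * (k %| n)%N%:R - X%:R / k%:R| <= Del.

Let Del0 : 0 <= Del.
Proof. exact: le_trans (reg (k := 1) isT). Qed.

Lemma coef_bound (c : nat -> R) : (forall r, (0 < r)%N -> `|c r| <= r%:R^-1) ->
  (\sum_(1 <= r < N.+1 | sqfree r) `|c r| * r%:R ^+ 2) ^+ 2 <= N%:R ^+ 4.
Proof.
move=> hc; have -> : N%:R ^+ 4 = (N%:R * N%:R) ^+ 2 :> R by ring.
rewrite ler_pXn2r ?nnegrE ?mulr_ge0 //; last first.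
  by apply: sumr_ge0 => r _; rewrite mulr_ge0 ?exprn_ge0.
have -> : N%:R * N%:R = \sum_(1 <= r < N.+1) N%:R :> R.
  by rewrite big_const_nat subn1 /= iter_addr_0 mulr_natl.
rewrite big_mkcond !big_nat; apply: ler_sum => r /andP[r0 rN].
case: ifP => // _; have r0' : 0 < r%:R :> R by rewrite ltr0n.
apply: le_trans (ler_wpM2r (exprn_ge0 2 (ltW r0')) (hc r r0)) _.
by rewrite expr2 mulKf ?gt_eqF // ler_nat.
Qed.

Lemma mass_total : X%:R * sqfG R N - Del * N%:R ^+ 4 <=
  \sum_(1 <= n < X.+1) v n * selw R N n ^+ 2.
Proof.
have := @mean_square_ramf R _ v (fun r => r%:R^-1) X%:R Del 1 N
  (fun k k0 _ => reg k0) isT.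
move=> /(_ _)/wrap[r|]; first by rewrite coprime1n.
rewrite -/(selw R N _) -/(sqfG R N) ler_norml => /andP[h _].
have := coef_bound (c := fun r => r%:R^-1) _.
move=> /(_ _)/wrap[r r0|/(ler_wpM2l Del0)]; first by rewrite ger0_norm ?invr_ge0.
move: h; rewrite -/(sqfG R N).
set a := \sum_(1 <= n < X.+1) _; set b := (\sum_(1 <= r < N.+1 | sqfree r) _) ^+ 2.
by move=> h1 h2; apply: le_trans (_ : X%:R * sqfG R N - Del * b <= _); lra.
Qed.

(** The coefficients [selcp] equal to [1 / (p * m)] give the term [sqfG / p ^ 2]; those left at
    [1 / m], for [N / p < m <= N], give [ln (2 * p)] by [sum_inv_tail]. The mean square on multiples
    of [p] thus nearly gains a further factor [1 / p ^ 2], so that subtracting over all [p <= z]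
    leaves a positive main term. *)
Lemma mass_p (p : nat) : prime p -> (p <= N)%N ->
  \sum_(1 <= n < X.+1) v n * (p %| n)%N%:R * selw R N n ^+ 2 <=
  X%:R / p%:R * (sqfG R N / p%:R ^+ 2 + ln (2 * p%:R)) + Del * N%:R ^+ 4.
Proof.
move=> pp pN; have p0 := prime_gt0 pp; have p0' : 0 < p%:R :> R by rewrite ltr0n.
have reg' k : (0 < k)%N -> coprime p k ->
    `|\sum_(1 <= n < X.+1) (v n * (p %| n)%N%:R) * (k %| n)%N%:R - X%:R / p%:R / k%:R| <= Del.
  move=> k0 pk; have := reg (k := (p * k)%N); rewrite muln_gt0 p0 k0 => /(_ isT).
  rewrite natrM invfM mulrA; congr (`|_ - _| <= _); apply: eq_bigr => n _.
  by rewrite Gauss_dvd // -mulrA -natrM mulnb.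
have cz r : ~~ coprime p r -> selcp R N p r = 0.
  by rewrite prime_coprime // negbK /selcp => ->.
have := mean_square_ramf N reg' p0 cz.
have -> : \sum_(1 <= n < X.+1) v n * (p %| n)%N%:R *
      (\sum_(1 <= r < N.+1 | sqfree r) selcp R N p r * ramf R r n) ^+ 2 =
    \sum_(1 <= n < X.+1) v n * (p %| n)%N%:R * selw R N n ^+ 2.
  apply: eq_bigr => n _; case: (boolP (p %| n)%N) => pn; last by rewrite mulr0 !mul0r.
  by rewrite (selw_dvd _ N pp pn).
rewrite ler_norml => /andP[_]; rewrite lerBlDr => /le_trans; apply.
rewrite addrC lerD //; last first.
  rewrite ler_wpM2l // coef_bound // => r r0; rewrite /selcp.
  have ri : 0 <= r%:R^-1 :> R by rewrite invr_ge0.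
  case: ifP => _; first by rewrite normr0.
  case: ifP => _; rewrite ger0_norm ?mulr1 ?mulr_ge0 ?invr_ge0 //.
  by rewrite ler_piMr // invf_le1 // ler1n.
rewrite ler_wpM2l ?divr_ge0 //.
apply: le_trans (_ : \sum_(1 <= r < N.+1 | sqfree r)
   (p%:R ^- 2 * (r%:R^-1 ^+ 2 * phir R r) + (N < p * r)%N%:R * r%:R^-1) <= _).
  rewrite big_nat_cond [leRHS]big_nat_cond; apply: ler_sum => r /andP[/andP[r0 _] sr].
  have ri : 0 < r%:R^-1 :> R by rewrite invr_gt0 ltr0n.
  have ph0 := @phir_ge0 R r; have phr := phir_le R sr.
  rewrite /selcp; case: ifP => _; first by rewrite expr0n mul0r addr_ge0 ?mulr_ge0 ?invr_ge0 ?exprn_ge0 // ltW.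
  rewrite ltnNge; case: leqP => _ /=.
    rewrite mul0r addr0 le_eqVlt; apply/orP; left; apply/eqP.
    by field; rewrite !pnatr_eq0 -!lt0n r0 p0.
  rewrite mulr1 mul1r; apply: le_trans (_ : r%:R^-1 <= _).
    by rewrite expr2 -mulrA ler_piMr ?(ltW ri) // ler_pdivrMl ?mulr1 // ltr0n.
  by rewrite lerDr !mulr_ge0 ?invr_ge0 ?exprn_ge0 ?(ltW ri).
rewrite big_split /= -mulr_sumr -/(sqfG R N) [in leRHS]mulrC lerD2l.
apply: le_trans (@sum_inv_tail R p N _); last by rewrite p0.
rewrite big_mkcond [leRHS]big_mkcond; apply: ler_sum => r _.
by case: (N < p * r)%N; rewrite ?mul1r ?mul0r; case: ifP => // _; rewrite invr_ge0.
Qed.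

End Mass.
End Sieve.

Section SieveLower.
Variable R : realType.

(** The weighted sum [W] of [v n * selw ^ 2 * (1 - om n)] has nonpositive terms off the rough
    numbers, and on them [selw] is at most [2 ^ B * sqfS]. From below, [mass_total] and [mass_p]
    evaluate it. *)
Lemma rough_sum_lower (v : nat -> R) (X B b z : nat) (Del : R) :
  (forall n, 0 <= v n) ->
  (forall k : nat, (0 < k)%N ->
    `|\sum_(1 <= n < X.+1) v n * (k %| n)%N%:R - X%:R / k%:R| <= Del) ->
  (1 < z)%N -> (256 <= b)%N -> (X <= z ^ B)%N ->
  X%:R * sqfS R (z ^ b) / 8 - Del * (z ^ b)%:R ^+ 4 * z.+1%:R <=
  4 ^+ B * sqfS R (z ^ b) ^+ 2 * \sum_(1 <= n < X.+1 | rough z n) v n.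
Proof.
move=> v0 reg z1 b256 XzB.
set N := (z ^ b)%N; set S := sqfS R N; set G := sqfG R N.
have z0 : (0 < z)%N by apply: ltnW.
have N0 : (0 < N)%N by rewrite expn_gt0 z0.
have zN : (z <= N)%N by rewrite -[leqLHS]expn1 leq_pexp2l // (leq_trans _ b256).
have Del0 : 0 <= Del by apply: le_trans (reg 1%N isT).
have lz0 : 0 <= ln z%:R :> R by rewrite ln_ge0 // ler1n.
(* The value 256 enters here: the terms [ln (2 * p)] will cost [4 * X * ln z], now at most
   [X * S / 32], against a main term [5 / 8 * X * G], which is at least [5 * X * S / 32]. *)
have SN : 128 * ln z%:R <= S.
  have := @sqfS_ge R N N0; rewrite -/S /N natrX lnXn ?ltr0n // -[_ *+ b]mulr_natl => h.
  have : 256 * ln z%:R <= b%:R * ln z%:R :> R by rewrite ler_wpM2r // ler_nat.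
  by lra.
have SG : S / 4 <= G := sqfG_ge R N.
have X0 : 0 <= X%:R :> R by [].
pose om n := \sum_(1 <= p < z.+1 | prime p) (p %| n)%N%:R : R.
pose W := \sum_(1 <= n < X.+1) v n * selw R N n ^+ 2 * (1 - om n).
have W1 : W <= 4 ^+ B * S ^+ 2 * \sum_(1 <= n < X.+1 | rough z n) v n.
  rewrite /W mulr_sumr [leRHS]big_mkcond !big_nat; apply: ler_sum => n /andP[n0 nX].
  have g0 : 0 <= v n * selw R N n ^+ 2 by rewrite mulr_ge0 // sqr_ge0.
  have om0 : 0 <= om n by apply: sumr_ge0.
  case: ifP => rn.
    apply: le_trans (_ : v n * selw R N n ^+ 2 <= _); first by rewrite ler_piMr // gerBl.
    rewrite mulrC ler_wpM2r // -real_normK ?num_real //.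
    have h : (size (primes n) <= B)%N.
      by apply: (rough_size z1 rn); rewrite n0 (leq_trans _ XzB).
    have -> : 4 ^+ B * S ^+ 2 = (2 ^+ B * S) ^+ 2 :> R.
      by rewrite exprMn -exprM mulnC exprM; congr (_ ^+ _ * _); ring.
    rewrite ler_pXn2r ?nnegrE ?mulr_ge0 ?exprn_ge0 ?sqfS_ge0 //.
    apply: le_trans (selw_norm_le R N n0) _.
    by rewrite ler_wpM2r ?sqfS_ge0 // ler_weXn2l // ler1n.
  rewrite mulr_ge0_le0 // subr_le0.
  move: rn => /negbT /allPn[p]; rewrite mem_primes -leqNgt => /and3P[pp _ pn] pz.
  rewrite /om big_mkcond (bigD1_seq p) ?iota_uniq ?mem_index_iota ?ltnS ?pz ?prime_gt0 //=.
  rewrite pp pn lerDl; apply: sumr_ge0 => q _; by case: ifP.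
have W2 : X%:R * G - Del * N%:R ^+ 4 - \sum_(1 <= p < z.+1 | prime p)
    (X%:R / p%:R * (G / p%:R ^+ 2 + ln (2 * p%:R)) + Del * N%:R ^+ 4) <= W.
  have -> : W = \sum_(1 <= n < X.+1) v n * selw R N n ^+ 2 -
      \sum_(1 <= p < z.+1 | prime p) \sum_(1 <= n < X.+1) v n * (p %| n)%N%:R * selw R N n ^+ 2.
    rewrite exchange_big -sumrB /=; apply: eq_bigr => n _.
    rewrite mulrBr mulr1 /om mulr_sumr; congr (_ - _); apply: eq_bigr => p _.
    by rewrite mulrAC.
  rewrite lerB //; first exact: mass_total.
  rewrite big_nat_cond [leRHS]big_nat_cond; apply: ler_sum => p /andP[/andP[p0 pz] pp].
  by apply: mass_p => //; apply: leq_trans zN.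
apply: le_trans W1; apply: le_trans W2.
(* Since [p >= 2], one has [1 / p ^ 3 <= 1 / (2 * p ^ 2)] and [ln (2 * p) <= 2 * ln p]. *)
have h1 : \sum_(1 <= p < z.+1 | prime p)
    (X%:R / p%:R * (G / p%:R ^+ 2 + ln (2 * p%:R)) + Del * N%:R ^+ 4) <=
  \sum_(1 <= p < z.+1 | prime p) (X%:R * G / 2 * (p%:R ^+ 2)^-1 +
     X%:R * 2 * (ln p%:R / p%:R)) + Del * N%:R ^+ 4 * z%:R.
  have -> : Del * N%:R ^+ 4 * z%:R = \sum_(1 <= p < z.+1) Del * N%:R ^+ 4.
    by rewrite big_const_nat subn1 /= iter_addr_0 mulr_natr.
  rewrite big_mkcond [X in _ <= X + _]big_mkcond -big_split /= !big_nat.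
  apply: ler_sum => p /andP[p0 pz]; case: ifP => pp; last first.
    by rewrite add0r mulr_ge0 ?exprn_ge0.
  rewrite lerD2r mulrDr.
  have p2 : 2 <= p%:R :> R by rewrite (ler_nat _ 2) prime_gt1.
  have p0' : 0 < p%:R :> R by rewrite ltr0n.
  have G0 : 0 <= G by apply: le_trans SG; rewrite divr_ge0 ?sqfS_ge0.
  apply: lerD.
    have -> : X%:R / p%:R * (G / p%:R ^+ 2) = X%:R * G * (p%:R ^+ 2)^-1 * p%:R^-1.
      by field; rewrite gt_eqF.
    have -> : X%:R * G / 2 / p%:R ^+ 2 = X%:R * G * (p%:R ^+ 2)^-1 * 2^-1 :> R.
      by field; rewrite gt_eqF.
    rewrite ler_wpM2l ?mulr_ge0 ?invr_ge0 ?exprn_ge0 //.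
    by rewrite lef_pV2 // posrE.
  have -> : X%:R * 2 * (ln p%:R / p%:R) = X%:R / p%:R * (2 * ln p%:R) :> R.
    by field; rewrite gt_eqF.
  rewrite ler_wpM2l ?divr_ge0 // lnM ?posrE // mulr2n mulrDl mul1r lerD2r.
  by rewrite ler_ln ?posrE.
have h2 : \sum_(1 <= p < z.+1 | prime p) (X%:R * G / 2 * (p%:R ^+ 2)^-1 +
     X%:R * 2 * (ln p%:R / p%:R)) <= X%:R * G / 2 * (3 / 4) + X%:R * 2 * (2 * ln z%:R).
  have G0 : 0 <= G by apply: le_trans SG; rewrite divr_ge0 ?sqfS_ge0.
  rewrite big_split /= -!mulr_sumr lerD //.
    by rewrite ler_wpM2l ?divr_ge0 ?mulr_ge0 // sum_prime_inv_sq.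
  by rewrite ler_wpM2l ?mulr_ge0 // sum_ln_prime_div.
have h3 : X%:R * (S / 4) <= X%:R * G by rewrite ler_wpM2l.
have h4 : X%:R * (128 * ln z%:R) <= X%:R * S by rewrite ler_wpM2l.
rewrite -[z.+1%:R]natr1; move: h1 h2 h3 h4; set s1 := \sum_(_ <= _ < _ | _) _.
set s2 := \sum_(_ <= _ < _ | _) _; set D := Del * _; lra.
Qed.

End SieveLower.

Section SieveLowerLn.
Variable R : realType.

(** With [N = z ^ b], the error is at most [(z + 1) ^ 2 * z ^ (4 * b)], and
    [16 * (z + 1) ^ 2 <= z ^ 6]; hence the condition [4 * b + 6 <= B], which makes the error at most
    half of the main term. *)
Lemma rough_sum_lower_ln (v : nat -> R) (B b z : nat) (Del : R) :
  (forall n, 0 <= v n) ->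
  (forall k : nat, (0 < k)%N ->
    `|\sum_(1 <= n < (z ^ B).+1) v n * (k %| n)%N%:R - (z ^ B)%:R / k%:R| <= Del) ->
  (2 < z)%N -> (256 <= b)%N -> (4 * b + 6 <= B)%N -> Del <= z.+1%:R ->
  (z ^ B)%:R <= 16 * 4 ^+ B * (1 + ln (z ^ B)%:R) *
    \sum_(1 <= n < (z ^ B).+1 | rough z n) v n.
Proof.
move=> v0 reg z2 b256 bB Dz.
have := rough_sum_lower v0 reg (ltnW z2) b256 (leqnn _).
set X := (z ^ B)%N; set N := (z ^ b)%N; set S := sqfS R N.
set s := \sum_(_ <= _ < _ | _) _.
have z0 : (0 < z)%N by apply: leq_trans z2.
have N0 : (0 < N)%N by rewrite expn_gt0 z0.
have X0 : (0 < X)%N by rewrite expn_gt0 z0.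
have NX : (N <= X)%N by rewrite leq_pexp2l //; move: bB; lia.
have s0 : 0 <= s by apply: sumr_ge0.
have S1 : 1 <= S.
  rewrite /S /sqfS big_mkcond big_ltn //= invr1 lerDl.
  by apply: sumr_ge0 => r _; case: ifP.
have SX : S <= 1 + ln X%:R.
  apply: le_trans (_ : 1 + ln N%:R <= _); last first.
    by rewrite lerD2l ler_ln ?posrE ?ltr0n // ler_nat.
  apply: le_trans (harmonic_le1 R N0); rewrite /S /sqfS big_mkcond.
  by apply: ler_sum => r _; case: ifP.
have err : Del * N%:R ^+ 4 * z.+1%:R <= X%:R * S / 16.
  apply: le_trans (_ : X%:R / 16 <= _); last by rewrite ler_wpM2r // ler_peMr.
  rewrite ler_pdivlMr //.
  apply: le_trans (_ : z.+1%:R * N%:R ^+ 4 * z.+1%:R * 16 <= _).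
    by rewrite !ler_wpM2r // exprn_ge0.
  rewrite -natrX -!natrM ler_nat.
  apply: leq_trans (_ : z ^ (4 * b + 6) <= _)%N; last by rewrite leq_pexp2l.
  rewrite /N -expnM [(b * 4)%N]mulnC expnD.
  have h : (z.+1 * z.+1 * 16 <= z ^ 6)%N.
    have h0 : (4 * z.+1 <= z * z * z)%N by nia.
    rewrite (_ : z ^ 6 = z * z * z * (z * z * z))%N; last by rewrite !expnS; nia.
    by apply: leq_trans (leq_mul h0 h0); nia.
  have := leq_mul (leqnn (z ^ (4 * b))) h; nia.
have Sp : 0 < S by lra.
move=> main.
have h1 : X%:R * S / 16 <= 4 ^+ B * S ^+ 2 * s.
  apply: le_trans main; lra.
have h2 : X%:R <= 16 * 4 ^+ B * S * s.
  rewrite -(ler_pM2r Sp).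
  have -> : 16 * 4 ^+ B * S * s * S = 16 * (4 ^+ B * S ^+ 2 * s) by ring.
  by move: h1; lra.
apply: le_trans h2 _; rewrite ler_wpM2r // ler_wpM2l // mulr_ge0 ?exprn_ge0 //.
Qed.

End SieveLowerLn.

(** * Dirichlet characters *)

Section CharDef.
Variable R : realType.
Local Notation C := R[i].

(** The last clause packs two facts: [chi] vanishes off the residues prime to [d] and is unimodular
    on them. Functions on [nat] let characters of different moduli be multiplied and compared
    directly. *)
Definition dchar (d : nat) (chi : nat -> C) : Prop :=
  [/\ (0 < d)%N, forall m n, chi (m * n)%N = chi m * chi n,
      forall m n, (m = n %[mod d])%N -> chi m = chi n
    & forall n, `|chi n| = (coprime d n)%:R].

Definition nonprincipal (d : nat) (chi : nat -> C) : Prop :=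
  exists2 n, coprime d n & chi n != 1.

Lemma dchar1 d chi : dchar d chi -> chi 1%N = 1.
Proof.
case=> _ M _ N; have := N 1%N; rewrite coprimen1 => n1.
have c0 : chi 1%N != 0 by rewrite -normr_eq0 n1 oner_eq0.
by apply: (mulfI c0); rewrite -M mulr1.
Qed.

Lemma dchar_nonprincipal_gt1 d chi : dchar d chi -> nonprincipal d chi -> (1 < d)%N.
Proof.
move=> hc [n _ cn]; case: (hc) => d0 _ P _; rewrite ltn_neqAle d0 andbT.
apply: contra cn => /eqP d1; rewrite -(dchar1 hc); apply/eqP/P.
by rewrite -d1 !modn1.
Qed.

Lemma dchar0 d chi : dchar d chi -> (1 < d)%N -> chi 0%N = 0.
Proof.
move=> [_ _ _ N] d1; apply/eqP; rewrite -normr_eq0 N.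
by rewrite /coprime gcdn0 gtn_eqF.
Qed.

Lemma dchar_sum_period d chi : dchar d chi -> nonprincipal d chi ->
  \sum_(0 <= n < d) chi n = 0.
Proof.
move=> hc [u du cu]; case: hc => d0 M P N.
rewrite big_mkord.
pose h (i : 'I_d) : 'I_d := Ordinal (ltn_pmod (u * i) d0).
have hinj : injective h.
  move=> i j /(congr1 val) /= /eqP e.
  have : (u * i == u * j %[mod d])%N by [].
  wlog ij : i j {e} / (i <= j)%N.
    move=> W; case/orP: (leq_total i j) => ij; first exact: W.
    by rewrite eq_sym => /W -/(_ ij).
  rewrite eq_sym eqn_mod_dvd ?leq_mul2l ?ij ?orbT // -mulnBr Gauss_dvdr // => dd.
  apply/val_inj/eqP => /=; rewrite eqn_leq ij /= -subn_eq0; apply/eqP.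
  have jd : (j - i < d)%N by rewrite (leq_ltn_trans (leq_subr _ _)).
  by have := modn_small jd; rewrite (eqP dd).
have e : \sum_(i < d) chi i = chi u * \sum_(i < d) chi i.
  rewrite {1}(reindex_inj hinj) mulr_sumr; apply: eq_bigr => i _ /=.
  by rewrite -M; apply: P; rewrite modn_mod.
apply/eqP; have : (chi u - 1) * \sum_(i < d) chi i = 0 by rewrite mulrBl mul1r -e subrr.
by move/eqP; rewrite mulf_eq0 subr_eq0 (negbTE cu).
Qed.

Lemma dchar_norm_le1 d chi n : dchar d chi -> `|chi n| <= 1.
Proof. by case=> _ _ _ N; rewrite N; case: (coprime _ _). Qed.

Lemma dchar_sum_le d chi N : dchar d chi -> nonprincipal d chi ->
  `|\sum_(0 <= n < N) chi n| <= d%:R.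
Proof.
move=> hc hn; case: (hc) => d0 M P _.
have H k r : \sum_(0 <= n < k * d + r) chi n = \sum_(0 <= n < r) chi n.
  elim: k => [|k IH]; first by rewrite mul0n.
  rewrite mulSn -addnA (big_cat_nat (n := d)) ?leq_addr //= dchar_sum_period // add0r.
  rewrite -[X in \sum_(X <= _ < _) _]add0n big_addn addKn -IH.
  by apply: eq_bigr => i _; apply: P; rewrite modnDr.
rewrite (divn_eq N d) H; apply: le_trans (ler_norm_sum _ _ _) _.
apply: le_trans (_ : \sum_(0 <= n < N %% d) 1 <= _).
  by apply: ler_sum => n _; apply: dchar_norm_le1 hc.
by rewrite big_const_nat subn0 iter_addr_0 ler_nat ltnW // ltn_pmod.
Qed.

Lemma dchar_sum1_le d chi N : dchar d chi -> nonprincipal d chi ->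
  `|\sum_(1 <= n < N.+1) chi n| <= d%:R.
Proof.
move=> hc hn; have := dchar_sum_le N.+1 hc hn.
by rewrite big_ltn // (dchar0 hc (dchar_nonprincipal_gt1 hc hn)) add0r.
Qed.

Lemma dchar_mulC d d' chi chi' : dchar d chi -> dchar d' chi' ->
  dchar (d * d') (fun n => (chi n)^* * chi' n).
Proof.
case=> d0 M P N [d0' M' P' N']; split.
- by rewrite muln_gt0 d0.
- by move=> m n; rewrite M M' rmorphM; ring.
- move=> m n e; rewrite (P m n) ?(P' m n) //.
    by rewrite -(modn_dvdm m (dvdn_mull d (dvdnn d'))) e modn_dvdm // dvdn_mull.
  by rewrite -(modn_dvdm m (dvdn_mulr d' (dvdnn d))) e modn_dvdm // dvdn_mulr.
by move=> n; rewrite normrM norm_conjC N N' coprimeMl -natrM mulnb.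
Qed.

End CharDef.

(** * Small moduli *)

Section Small.
Variable R : realType.
Local Notation C := R[i].
Local Notation re := (@complex.Re R).

Lemma reD (x y : C) : re (x + y) = re x + re y. Proof. by case: x y => [a b] [c d]. Qed.

Lemma re_sum (I : Type) (s : seq I) (P : pred I) (F : I -> C) :
  re (\sum_(i <- s | P i) F i) = \sum_(i <- s | P i) re (F i).
Proof. exact: (big_morph re reD). Qed.

Lemma re_norm_le (x : C) (a : R) : `|x| <= a%:C%C -> `|re x| <= a.
Proof. by move=> h; rewrite -lecR; apply: le_trans h; apply: normc_ge_Re. Qed.

Lemma re_norm_le_nat (x : C) (n : nat) : `|x| <= n%:R -> `|re x| <= n%:R.
Proof. by move=> h; apply: re_norm_le; rewrite rmorph_nat. Qed.

Lemma re_dchar_le1 d (chi : nat -> C) n : dchar d chi -> `|re (chi n)| <= 1.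
Proof. by move=> hc; apply: (@re_norm_le_nat _ 1); apply: dchar_norm_le1 hc. Qed.

(** For [|w| = 1], [|1 - w| ^ 2 = 2 * (1 - re w)], and [|1 - x * y|] is at most
    [|1 - x| + |1 - y|]. *)
Lemma dist1_mul (x y : C) : `|x| = 1 -> `|y| = 1 ->
  1 - re (x * y) <= 2 * (1 - re x) + 2 * (1 - re y).
Proof.
have sq (w : C) : `|w| = 1 -> re w ^+ 2 + complex.Im w ^+ 2 = 1.
  move=> h; have := add_Re2_Im2 w; rewrite h expr1n => H; exact: (congr1 re H).
move=> /sq + /sq; case: x y => [a b] [c d] /= h1 h2.
(* This is [|1 - 2 x + x y| ^ 2], the other diagonal in the parallelogram law for [1 - x] and
   [x * (1 - y)]. *)
have : 0 <= (1 - 2 * a + (a * c - b * d)) ^+ 2 + (- 2 * b + (a * d + b * c)) ^+ 2.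
  by rewrite addr_ge0 // sqr_ge0.
have -> : (1 - 2 * a + (a * c - b * d)) ^+ 2 + (- 2 * b + (a * d + b * c)) ^+ 2 =
  1 + 4 * (a ^+ 2 + b ^+ 2) + (a ^+ 2 + b ^+ 2) * (c ^+ 2 + d ^+ 2) - 4 * a
  + 2 * (a * c - b * d) - 4 * (a ^+ 2 + b ^+ 2) * c by ring.
rewrite h1 h2; lra.
Qed.

Lemma sum_dvd_reindex (V : pzSemiRingType) (F : nat -> V) (X k : nat) : (0 < k)%N ->
  \sum_(1 <= n < X.+1) F n * (k %| n)%N%:R = \sum_(1 <= m < (X %/ k).+1) F (k * m)%N.
Proof.
move=> k0; rewrite (eq_bigr (fun n => if (k %| n)%N then F n else 0)); last first.
  by move=> n _; case: (k %| n)%N; rewrite ?mulr1 ?mulr0.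
rewrite -big_mkcond -[LHS]big_filter -(big_map (muln k) xpredT F); apply: perm_big.
apply: uniq_perm.
- exact/filter_uniq/iota_uniq.
- rewrite map_inj_uniq ?iota_uniq //.
  by move=> a b /eqP; rewrite eqn_pmul2l // => /eqP.
move=> n; rewrite mem_filter mem_index_iota; apply/idP/mapP.
  case/and3P=> /dvdnP[m ->] m0 mX; exists m; last by rewrite mulnC.
  move: m0 mX; rewrite mem_index_iota !ltnS leq_divRL // => m0 ->.
  by move: m0; rewrite muln_gt0 => /andP[->].
case=> m; rewrite mem_index_iota ltnS leq_divRL // => /andP[m0 mX] ->.
by rewrite dvdn_mulr // muln_gt0 k0 m0 ltnS mulnC.
Qed.

(** On the multiples of [k] the character sum is [chi k] times a sum over an initial interval, at
    most [d] by periodicity; rounding [X / k] costs [1]. So [1 - re (chi n)] is nonnegative and as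
    regular as the constant [1], and the sieve applies to it. *)
Lemma dchar_regular d (chi : nat -> C) (X k : nat) : dchar d chi -> nonprincipal d chi ->
  (0 < k)%N ->
  `|\sum_(1 <= n < X.+1) (1 - re (chi n)) * (k %| n)%N%:R - X%:R / k%:R| <= d.+1%:R.
Proof.
move=> hc hn k0; rewrite sum_dvd_reindex // sumrB.
have -> : \sum_(1 <= m < (X %/ k).+1) 1 = (X %/ k)%:R :> R.
  by rewrite big_const_nat subn1 iter_addr_0.
have h1 : `|\sum_(1 <= m < (X %/ k).+1) re (chi (k * m)%N)| <= d%:R.
  rewrite -re_sum; apply: re_norm_le_nat; case: (hc) => _ M _ N.
  under eq_bigr => m _ do rewrite M.
  rewrite -mulr_sumr normrM -[d%:R]mul1r; apply: ler_pM => //.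
    exact: dchar_norm_le1 hc.
  exact: dchar_sum1_le.
have k0' : 0 < k%:R :> R by rewrite ltr0n.
have h2 : `|(X %/ k)%:R - X%:R / k%:R| <= 1 :> R.
  have hk : k%:R != 0 :> R by rewrite gt_eqF.
  have -> : (X %/ k)%:R - X%:R / k%:R = - ((X %% k)%:R / k%:R) :> R.
    by rewrite {2}(divn_eq X k) natrD natrM; field.
  rewrite normrN ger0_norm ?divr_ge0 // ler_pdivrMr // mul1r ler_nat ltnW //.
  exact: ltn_pmod.
set s := \sum_(_ <= _ < _) _ in h1 *.
rewrite addrAC; apply: le_trans (ler_normB _ _) _.
by apply: le_trans (lerD h2 h1) _; rewrite addrC natr1.
Qed.

(** Splitting off the least prime factor by [dist1_mul] turns a constant [c] into [2 + 2 * c], which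
    starting from [0] gives [2 ^ (B + 1) - 2]. Roughness with [d <= z] makes all values involved
    unimodular and bounds the depth. *)
Lemma rough_dist1_le (z B d : nat) (chi : nat -> C) : dchar d chi -> (1 < d <= z)%N ->
  forall n, rough z n -> (0 < n < z ^ B)%N ->
  1 - re (chi n) <= (2 ^+ B.+1 - 2) * \sum_(p <- primes n) (1 - re (chi p)).
Proof.
move=> hc /andP[d1 dz]; have z0 : (0 < z)%N by apply: leq_trans dz; apply: ltnW.
have v0 p : 0 <= 1 - re (chi p).
  by rewrite subr_ge0 (le_trans (ler_norm _)) // (re_dchar_le1 _ hc).
have hz p : prime p -> (z < p)%N -> `|chi p| = 1.
  case: hc => d0 _ _ N pp zp; rewrite N coprime_sym prime_coprime //.
  by rewrite gtnNdvd // (leq_ltn_trans dz).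
have K0 b : 0 <= 2 ^+ b.+1 - 2 :> R.
  by rewrite subr_ge0 exprS ler_peMr // exprn_ege1 // ler1n.
elim: B => [|B IH] n rn /andP[n0 nz]; first by move: nz; rewrite ltnNge n0.
have S0 m : 0 <= \sum_(p <- primes m) (1 - re (chi p)) by apply: sumr_ge0.
have [n1|n1] := leqP n 1%N.
  have -> : n = 1%N by apply/eqP; rewrite eqn_leq n1.
  by rewrite (dchar1 hc) /= subrr mulr_ge0 ?K0.
pose p := pdiv n; have pp : prime p := pdiv_prime n1.
have pn : p \in primes n by rewrite mem_primes pp n0 pdiv_dvd.
have zp : (z < p)%N by apply: (allP rn).
case/dvdnP: (pdiv_dvd n) => m em; rewrite -/p in em.
have m0 : (0 < m)%N by move: n0; rewrite em muln_gt0 => /andP[].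
have sub : {subset primes m <= primes n} by move=> q; rewrite em primesM ?(prime_gt0 pp) // => ->.
have rm : rough z m by apply/allP => q /sub; apply: (allP rn).
have mz : (0 < m < z ^ B)%N.
  rewrite m0 /= -(ltn_pmul2r z0) -expnSr; apply: leq_ltn_trans nz.
  by rewrite em leq_mul2l (ltnW zp) orbT.
have nm : `|chi m| = 1.
  case: (hc) => d0 _ _ N; rewrite N coprime_has_primes //.
  have -> // : has (fun q => q \in primes d) (primes m) = false.
  apply/hasPn => q /(allP rm) zq; rewrite mem_primes; apply/negP => /and3P[_ _ /(dvdn_leq d0)].
  by rewrite leqNgt (leq_ltn_trans dz).
have := IH m rm mz.
have -> : chi n = chi p * chi m by case: (hc) => _ M _ _; rewrite -M mulnC -em.
have := dist1_mul (hz p pp zp) nm.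
have sm : \sum_(q <- primes m) (1 - re (chi q)) <= \sum_(q <- primes n) (1 - re (chi q)).
  rewrite [leRHS](bigID (mem (primes m))) /= -[leLHS]addr0 lerD //; last by apply: sumr_ge0.
  rewrite -[leRHS]big_filter le_eqVlt; apply/orP; left; apply/eqP.
  apply: perm_big; apply: uniq_perm; rewrite ?filter_uniq ?primes_uniq // => q.
  by rewrite mem_filter; case: (boolP (q \in primes m)) => //= /sub ->.
have sp : 1 - re (chi p) <= \sum_(q <- primes n) (1 - re (chi q)).
  rewrite (bigD1_seq p) ?primes_uniq //= lerDl.
  exact: sumr_ge0.
have S0n := S0 n; have S0m := S0 m.
have e1 : (2 ^+ B.+1 - 2) * \sum_(q <- primes m) (1 - re (chi q)) <=
          (2 ^+ B.+1 - 2) * \sum_(q <- primes n) (1 - re (chi q)).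
  by rewrite ler_wpM2l.
move: e1 sp; rewrite [2 ^+ B.+2]exprS.
set a := \sum_(q <- primes n) _; set c := \sum_(q <- primes m) _; set t := 2 ^+ B.+1.
lra.
Qed.

(* The value [2] at the divisors of [d] (where [chi] vanishes) makes [hval]
   decrease when [chi] is replaced by a character of smaller modulus inducing it. *)
Definition hval (d : nat) (chi : nat -> C) (p : nat) : R :=
  if (p %| d)%N then 2 else 1 - re (chi p).

Definition Hsum (z X d : nat) (chi : nat -> C) : R :=
  \sum_(z.+1 <= p < X.+1 | prime p) hval d chi p / p%:R.

Lemma hval_ge d chi p : dchar d chi -> 1 - re (chi p) <= hval d chi p.
Proof.
move=> hc; rewrite /hval; case: ifP => // _; rewrite lerBlDr -lerBlDl.
have := re_dchar_le1 p hc; rewrite ler_norml => /andP[h _]; lra.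
Qed.

Lemma dist1_ge0 d chi p : dchar d chi -> 0 <= 1 - re (chi p).
Proof. by move=> hc; rewrite subr_ge0 (le_trans (ler_norm _)) // (re_dchar_le1 _ hc). Qed.

(** The sieve shows that [1 - re (chi n)] has a large sum over rough [n <= X]. Replacing it by a sum
    over the primes dividing [n], each prime [p] occurs for at most [X / p] values of [n], which
    produces [X * Hsum]. *)
Lemma Hsum_small (z b B d : nat) (chi : nat -> C) :
  dchar d chi -> nonprincipal d chi -> (d <= z)%N -> (2 < z)%N ->
  (256 <= b)%N -> (4 * b + 6 <= B)%N ->
  1 <= 2 ^+ (B + 6) * 4 ^+ B * (1 + ln (z ^ B)%:R) * Hsum z (z ^ B) d chi.
Proof.
move=> hc hn dz z2 b256 bB; set X := (z ^ B)%N.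
have z0 : (0 < z)%N by apply: leq_trans z2.
have X0 : (0 < X)%N by rewrite expn_gt0 z0.
have v0 n : 0 <= 1 - re (chi n) by apply: dist1_ge0 hc.
have := rough_sum_lower_ln v0 (fun k k0 => dchar_regular (z ^ B) hc hn k0) z2 b256 bB _.
rewrite -/X => /(_ _)/wrap[|main]; first by rewrite ler_nat.
have L0 : 0 <= ln X%:R :> R by rewrite ln_ge0 // ler1n.
have h1 : \sum_(1 <= n < X.+1 | rough z n) (1 - re (chi n)) <=
    2 ^+ B.+2 * (X%:R * Hsum z X d chi).
  apply: le_trans (_ : \sum_(1 <= n < X.+1 | rough z n)
      2 ^+ B.+2 * \sum_(p <- primes n) (1 - re (chi p)) <= _).
    rewrite big_nat_cond [leRHS]big_nat_cond; apply: ler_sum => n /andP[/andP[n0 nX] rn].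
    (* [n = z ^ B] is allowed here, whereas [rough_dist1_le] needs a strict inequality; hence
       [B + 1] and the constant [2 ^ (B + 2)]. *)
    apply: le_trans (rough_dist1_le (B := B.+1) hc _ rn _) _.
    - by rewrite (dchar_nonprincipal_gt1 hc hn).
    - rewrite n0 expnS -/X /=; move: nX X0 z2; rewrite ltnS; move: (X) => Y; nia.
    by rewrite ler_wpM2r ?gerBl //; apply: sumr_ge0.
  rewrite -mulr_sumr ler_wpM2l ?exprn_ge0 //.
  apply: le_trans (_ : \sum_(1 <= n < X.+1) \sum_(z.+1 <= p < X.+1 | prime p)
     (p %| n)%N%:R * (1 - re (chi p)) <= _).
    rewrite big_mkcond !big_nat; apply: ler_sum => n /andP[n0 nX].
    case: ifP => rn; last by apply: sumr_ge0 => p _; rewrite mulr_ge0.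
    have zX : (z <= X)%N by rewrite -[leqLHS]expn1 leq_pexp2l //; lia.
    rewrite (@sum_primesE _ _ _ X) ?n0 // (big_cat_nat (n := z.+1)) //= big_nat_cond big1 ?add0r //.
    move=> p /andP[/andP[p0 pz] pp]; case: (boolP (p %| n)%N) => pn; last by rewrite mul0r.
    move/allP: rn => /(_ p); rewrite mem_primes pp n0 pn => /(_ isT).
    by rewrite ltnNge -ltnS pz.
  rewrite exchange_big /= /Hsum mulr_sumr big_nat_cond [leRHS]big_nat_cond.
  apply: ler_sum => p /andP[/andP[zp pX] pp].
  rewrite -mulr_suml -natr_sum -divn_count_dvd.
  have p0 : 0 < p%:R :> R by rewrite ltr0n prime_gt0.
  have -> : X%:R * (hval d chi p / p%:R) = X%:R / p%:R * hval d chi p by ring.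
  apply: ler_pM => //; last exact: hval_ge.
  by rewrite ler_pdivlMr // -natrM ler_nat leq_trunc_div.
have X0' : 0 < X%:R :> R by rewrite ltr0n.
have c0 : 0 <= 16 * 4 ^+ B * (1 + ln X%:R) :> R by rewrite !mulr_ge0 ?addr_ge0 ?exprn_ge0.
have := le_trans main (ler_wpM2l c0 h1).
rewrite -[X in X <= _](mulr1 X%:R).
have -> : 16 * 4 ^+ B * (1 + ln X%:R) * (2 ^+ B.+2 * (X%:R * Hsum z X d chi)) =
  X%:R * (2 ^+ (B + 6) * 4 ^+ B * (1 + ln X%:R) * Hsum z X d chi).
  by rewrite exprD !exprS; ring.
by rewrite ler_pM2l.
Qed.

End Small.

(** * Large sieve *)

Section LargeSieve.
Variable R : realType.
Local Notation C := R[i].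

(* With [b d] the inner sum and [al] the constant, expand
   [0 <= \sum_n |al * a n - \sum_d b d * (chi d n)^*| ^ 2]. *)
Lemma large_sieve (ds : seq nat) (chi : nat -> nat -> C) (N D : nat) (a : nat -> C) :
  uniq ds -> (0 < N)%N ->
  (forall d, d \in ds -> (d <= D)%N /\ dchar d (chi d)) ->
  (forall d d', d \in ds -> d' \in ds -> d != d' ->
     nonprincipal (d * d') (fun n => (chi d n)^* * chi d' n)) ->
  \sum_(d <- ds) `|\sum_(1 <= n < N.+1) a n * chi d n| ^+ 2 <=
  (N + size ds * D ^ 2)%:R * \sum_(1 <= n < N.+1) `|a n| ^+ 2.
Proof.
move=> uds N0 hd hdd.
pose b d := \sum_(1 <= n < N.+1) a n * chi d n.
pose T := \sum_(d <- ds) `|b d| ^+ 2; rewrite -/T.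
set A := \sum_(_ <= _ < _) _; set al : C := (N + _)%:R.
have al0 : 0 < al by rewrite ltr0n addn_gt0 N0.
have alJ : al^* = al by rewrite conj_Creal // realn.
pose Y := \sum_(1 <= n < N.+1) `|\sum_(d <- ds) b d * (chi d n)^*| ^+ 2.
have pos : 0 <= \sum_(1 <= n < N.+1) `|al * a n - \sum_(d <- ds) b d * (chi d n)^*| ^+ 2.
  by apply: sumr_ge0 => n _; rewrite exprn_ge0.
have TE : T = \sum_(1 <= n < N.+1) a n * (\sum_(d <- ds) b d * (chi d n)^*)^*.
  rewrite /T; under [RHS]eq_bigr => n _ do rewrite rmorph_sum mulr_sumr.
  rewrite exchange_big /=; apply: eq_bigr => d _.
  rewrite normCK {1}/b mulr_suml; apply: eq_bigr => n _.
  by rewrite rmorphM /= conjCK; ring.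
have TJ : T^* = T.
  by rewrite conj_Creal //; apply: ger0_real; apply: sumr_ge0 => d _; rewrite exprn_ge0.
have TE' : T = \sum_(1 <= n < N.+1) (a n)^* * (\sum_(d <- ds) b d * (chi d n)^*).
  by rewrite -TJ TE rmorph_sum; apply: eq_bigr => n _; rewrite rmorphM /= conjCK.
have expand : \sum_(1 <= n < N.+1) `|al * a n - \sum_(d <- ds) b d * (chi d n)^*| ^+ 2 =
    al ^+ 2 * A - al * T - al * T + Y.
  rewrite {1}TE TE' /A /Y !mulr_sumr -!sumrB -big_split /=; apply: eq_bigr => n _.
  by rewrite !normCK rmorphB rmorphM /= alJ; ring.
(* The diagonal sums are at most [N] and the others at most [d * d' <= D ^ 2], the modulus of the
   product character. Replacing [|b d| * |b d'|] by the mean of the squares makes the total exactly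
   [al * T]. *)
have YT : Y <= al * T.
  have -> : al * T = \sum_(d <- ds) \sum_(d' <- ds)
     ((d == d')%:R * N%:R * `|b d| ^+ 2 + D%:R ^+ 2 * ((`|b d| ^+ 2 + `|b d'| ^+ 2) / 2)).
    have -> : \sum_(d <- ds) \sum_(d' <- ds)
     ((d == d')%:R * N%:R * `|b d| ^+ 2 + D%:R ^+ 2 * ((`|b d| ^+ 2 + `|b d'| ^+ 2) / 2)) =
      \sum_(d <- ds) (N%:R * `|b d| ^+ 2 + D%:R ^+ 2 / 2 * ((size ds)%:R * `|b d| ^+ 2 + T)).
      rewrite !big_seq; apply: eq_bigr => d dds; rewrite big_split /=; congr (_ + _).
        rewrite (bigD1_seq d) //= eqxx mul1r big1 ?addr0 // => d'.
        by rewrite eq_sym => /negbTE ->; rewrite !mul0r.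
      have -> : (size ds)%:R * `|b d| ^+ 2 = \sum_(d' <- ds) `|b d| ^+ 2.
        by rewrite big_const_seq iter_addr_0 count_predT mulr_natl.
      by rewrite /T -big_split mulr_sumr; apply: eq_bigr => d' _ /=; field.
    rewrite big_split /= -!mulr_sumr -/T big_split /= -mulr_sumr -/T.
    rewrite big_const_seq iter_addr_0 count_predT -[T *+ _]mulr_natl.
    by rewrite /al natrD natrM natrX; field.
  have YE : Y = \sum_(d <- ds) \sum_(d' <- ds)
     b d * (b d')^* * \sum_(1 <= n < N.+1) (chi d n)^* * chi d' n.
    rewrite /Y; under eq_bigr => n _ do rewrite normCK rmorph_sum big_distrlr /=.
    rewrite exchange_big /=; apply: eq_bigr => d _.
    rewrite exchange_big /=; apply: eq_bigr => d' _.
    rewrite mulr_sumr; apply: eq_bigr => n _.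
    by rewrite rmorphM /= conjCK; ring.
  have Y0 : 0 <= Y by apply: sumr_ge0 => n _; rewrite exprn_ge0.
  rewrite -(ger0_norm Y0) YE.
  apply: le_trans (ler_norm_sum _ _ _) _; rewrite !big_seq; apply: ler_sum => d hd1.
  apply: le_trans (ler_norm_sum _ _ _) _; rewrite !big_seq; apply: ler_sum => d' hd2.
  have [dD hc] := hd d hd1; have [dD' hc'] := hd d' hd2.
  have amgm : `|b d| * `|b d'| <= (`|b d| ^+ 2 + `|b d'| ^+ 2) / 2.
    rewrite ler_pdivlMr // -subr_ge0.
    have -> : `|b d| ^+ 2 + `|b d'| ^+ 2 - `|b d| * `|b d'| * 2 = (`|b d| - `|b d'|) ^+ 2 by ring.
    by rewrite real_exprn_even_ge0 // rpredB // normr_real.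
  have am0 : 0 <= (`|b d| ^+ 2 + `|b d'| ^+ 2) / 2 by rewrite divr_ge0 ?addr_ge0 ?exprn_ge0.
  rewrite !normrM norm_conjC; have [<-|dd'] := eqVneq d d'.
    rewrite mul1r -expr2 mulrC; apply: ler_wpDr; first by rewrite mulr_ge0 ?exprn_ge0.
    rewrite ler_wpM2r ?exprn_ge0 //.
    apply: le_trans (ler_norm_sum _ _ _) _.
    apply: le_trans (_ : \sum_(1 <= n < N.+1) 1 <= _); last first.
      by rewrite big_const_nat subn1 iter_addr_0.
    apply: ler_sum => n _; rewrite normrM norm_conjC -[leRHS]mul1r.
    by apply: ler_pM => //; apply: dchar_norm_le1 hc.
  rewrite !mul0r add0r mulrC; apply: ler_pM => //.
  apply: le_trans (dchar_sum1_le N (dchar_mulC hc hc') (hdd d d' hd1 hd2 dd')) _.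
  by rewrite -natrX ler_nat -mulnn leq_mul.
have : 0 <= al ^+ 2 * A - al * T.
  apply: le_trans pos _; rewrite expand -[leRHS]addr0 -[X in _ <= _ + X](subrr (al * T)).
  by rewrite [X in _ <= _ + X]addrC addrA lerD2l.
rewrite subr_ge0 expr2 -mulrA ler_pM2l //.
Qed.

Section PrimeTuples.
Variable pr : seq nat.
Hypothesis prP : all prime pr.
Hypothesis prU : uniq pr.

(* Number of ordered factorizations of [n] into [k] primes of [pr]. *)
Fixpoint ntup (k n : nat) : nat :=
  if k is k'.+1 then (\sum_(p <- pr | p %| n) ntup k' (n %/ p))%N else (n == 1)%N.

Lemma ntup_supp (X k n : nat) : (forall p, p \in pr -> (p <= X)%N) ->
  (0 < ntup k n)%N -> (0 < n <= X ^ k)%N /\ (size (primes n) <= k)%N.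
Proof.
move=> hX; elim: k n => [|k IH] n /=; first by case: eqP => // ->.
rewrite lt0n -big_filter sum_nat_seq_neq0 => /hasP[p]; rewrite mem_filter => /andP[pn pp].
rewrite -lt0n => /IH[/andP[m0 mX] sm].
have ppr : prime p := allP prP p pp.
have en : n = (p * (n %/ p))%N by rewrite mulnC divnK.
have n0 : (0 < n)%N by rewrite en muln_gt0 prime_gt0.
split; first by rewrite n0 en expnS leq_mul // hX.
apply: leq_trans (_ : size (p :: primes (n %/ p)) <= _)%N; last by [].
apply: uniq_leq_size; first exact: primes_uniq.
by move=> q; rewrite {1}en primesM ?(prime_gt0 ppr) // primes_prime // !inE.
Qed.

(** A number with a nonzero count at level [k + 1] has at most [k + 1] distinct prime factors, hence
    as many choices for the first prime; the rest is induction. *)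
Lemma ntup_le (X k n : nat) : (forall p, p \in pr -> (p <= X)%N) -> (ntup k n <= k`!)%N.
Proof.
move=> hX; elim: k n => [|k IH] n; first by rewrite /=; case: eqP.
have [->//|] := posnP (ntup k.+1 n).
move/(ntup_supp hX) => [/andP[n0 _] sn] /=.
apply: leq_trans (_ : \sum_(p <- pr | (p %| n)%N) k`! <= _)%N; first exact: leq_sum.
rewrite big_const_seq iter_addn_0 factS mulnC leq_mul2r; apply/orP; right.
apply: leq_trans sn; rewrite -size_filter; apply: uniq_leq_size; first exact: filter_uniq.
by move=> p; rewrite mem_filter mem_primes n0 => /andP[-> /(allP prP) ->].
Qed.

Lemma sum_ntup (V : comPzRingType) (f : nat -> V) (X k : nat) :
  (forall m n, f (m * n)%N = f m * f n) -> f 1%N = 1 -> (0 < X)%N ->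
  (forall p, p \in pr -> (p <= X)%N) ->
  \sum_(1 <= n < (X ^ k).+1) (ntup k n)%:R * f n = (\sum_(p <- pr) f p) ^+ k.
Proof.
move=> fM f1 X0 hX; elim: k => [|k IH].
  by rewrite expr0 expn0 big_nat1 /= f1 mulr1.
transitivity (\sum_(1 <= n < (X ^ k.+1).+1) \sum_(p <- pr)
    (ntup k (n %/ p))%:R * f n * (p %| n)%N%:R : V).
  apply: eq_bigr => n _ /=; rewrite natr_sum mulr_suml big_mkcond.
  by apply: eq_bigr => p _; case: (p %| n)%N; rewrite ?mulr1 ?mulr0.
rewrite exchange_big /= exprS mulr_suml big_seq [RHS]big_seq; apply: eq_bigr => p pp.
have p0 : (0 < p)%N := prime_gt0 (allP prP p pp).
rewrite sum_dvd_reindex // -IH mulr_sumr.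
have le : (X ^ k <= X ^ k.+1 %/ p)%N.
  by rewrite leq_divRL // expnS mulnC leq_mul2r hX ?orbT.
rewrite (big_cat_nat (n := (X ^ k).+1)) //= [X in _ + X]big_nat_cond [X in _ + X]big1 ?addr0.
  by apply: eq_bigr => m _; rewrite mulKn // fM; ring.
move=> m /andP[/andP[mk _] _]; rewrite mulKn //.
have [->|/(ntup_supp hX)[/andP[_ h] _]] := posnP (ntup k m); first by rewrite mul0r.
by move: mk; rewrite ltnNge h.
Qed.

End PrimeTuples.
End LargeSieve.

(** * Chebyshev's lower bound *)

Section Chebyshev.

Lemma exp2_le_bin (n : nat) : (2 ^ n <= 'C(n.*2, n))%N.
Proof.
elim: n => // n IH; rewrite doubleS expnS mul2n -addnn binS leq_add //.
  by rewrite binS (leq_trans IH) // leq_addl.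
apply: leq_trans IH _; case: n => // n; by rewrite [leqRHS]binS leq_addr.
Qed.

(** By Legendre's formula the exponent of [p] is the sum over [k] of
    [2n %/ p ^ k - 2 * (n %/ p ^ k)]; each term is at most [1] and vanishes once [p ^ k > 2n]. *)
Lemma pfactor_bin_le (n p : nat) : (0 < n)%N -> prime p ->
  (p ^ logn p 'C(n.*2, n) <= n.*2)%N.
Proof.
move=> n0 pp; have p1 := prime_gt1 pp; have n20 : (0 < n.*2)%N by rewrite double_gt0.
have nn2 : (n <= n.*2)%N by rewrite -addnn leq_addr.
set t := trunc_log p n.*2.
apply: leq_trans (trunc_logP p1 n20); rewrite leq_pexp2l ?prime_gt0 // -/t.
have e2 : (n.*2 - n = n)%N by rewrite -addnn addnK.
have := bin_fact nn2; rewrite e2 => /(congr1 (logn p)).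
rewrite lognM ?muln_gt0 ?fact_gt0 ?bin_gt0 // lognM ?fact_gt0 // !logn_fact //.
set v := logn p _.
have e : (\sum_(1 <= k < n.+1) n %/ p ^ k = \sum_(1 <= k < n.*2.+1) n %/ p ^ k)%N.
  rewrite [RHS](big_cat_nat (n := n.+1)) //= [X in (_ = _ + X)%N]big_nat_cond [X in (_ = _ + X)%N]big1 ?addn0 //.
  move=> k /andP[/andP[nk _] _]; apply: divn_small.
  by apply: leq_trans (ltnW (ltn_expl k p1)).
rewrite e -big_split /= => h.
have : (\sum_(1 <= k < n.*2.+1) n.*2 %/ p ^ k <=
   \sum_(1 <= k < n.*2.+1) (n %/ p ^ k + n %/ p ^ k) + \sum_(1 <= k < n.*2.+1) (k <= t))%N.
  rewrite -big_split /= !big_nat; apply: leq_sum => k /andP[k0 _].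
  have pk : (0 < p ^ k)%N by rewrite expn_gt0 prime_gt0.
  case: (leqP k t) => kt.
    by have := divn_eq n (p ^ k); have := ltn_pmod n pk; have := divn_eq n.*2 (p ^ k);
       have := ltn_pmod n.*2 pk; rewrite -!muln2; nia.
  rewrite divn_small //; apply: leq_trans (trunc_log_ltn _ p1) _.
  by rewrite leq_pexp2l // prime_gt0.
rewrite -h addnC leq_add2l => /leq_trans; apply.
apply: leq_trans (_ : \sum_(1 <= k < n.*2.+1 | (k <= t)%N) 1 <= _)%N.
  by rewrite [leqRHS]big_mkcond; apply: leq_sum => k _; case: (k <= t)%N.
rewrite sum1_count -size_filter.
rewrite -[leqRHS](size_iota 1); apply: uniq_leq_size; first exact/filter_uniq/iota_uniq.
by move=> k; rewrite mem_filter mem_index_iota mem_iota add1n => /andP[kt /andP[-> _]]; rewrite ltnS.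
Qed.

Definition primes_le (n : nat) := [seq p <- index_iota 1 n.+1 | prime p].

Lemma exp2_le_primes (n : nat) : (0 < n)%N -> (2 ^ n <= n.*2 ^ size (primes_le n.*2))%N.
Proof.
move=> n0; apply: leq_trans (exp2_le_bin n) _.
have c0 : (0 < 'C(n.*2, n))%N by rewrite bin_gt0 -addnn leq_addr.
rewrite [leqLHS](prod_prime_decomp c0) prime_decompE big_map /=.
apply: leq_trans (_ : \prod_(p <- primes 'C(n.*2, n)) n.*2 <= _)%N.
  rewrite !big_seq; apply: leq_prod => p; rewrite mem_primes => /and3P[pp _ _].
  exact: pfactor_bin_le.
rewrite big_const_seq count_predT iter_muln_1 leq_pexp2l ?double_gt0 //.
apply: uniq_leq_size; first exact: primes_uniq.
move=> p; rewrite -logn_gt0 mem_filter mem_index_iota => lp.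
have pp : prime p by move: lp; rewrite lognE; case: ifP => // /andP[].
rewrite pp prime_gt0 //= ltnS; apply: leq_trans (pfactor_bin_le n0 pp).
by rewrite -[leqLHS]expn1 leq_pexp2l // prime_gt0.
Qed.

(** With [n = X./2], the bound [exp2_le_primes] reads [n * ln 2 <= size * ln X] after logarithms;
    [ln 2 >= 1 / 2] and [X <= 3 * n] fit inside the constant [8]. *)
Lemma size_primes_le_ge (R : realType) (X : nat) : (1 < X)%N ->
  X%:R <= 8 * ln X%:R * (size (primes_le X))%:R :> R.
Proof.
move=> X1; have X0 : (0 < X)%N := ltnW X1.
pose n := X./2; have n0 : (0 < n)%N by rewrite half_gt0.
have nX : (n.*2 <= X)%N by rewrite -[leqRHS]odd_double_half leq_addl.
have Xn : (X <= n.*2.+1)%N by rewrite -[leqLHS]odd_double_half -/n -add1n leq_add2r; case: odd.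
have mono : (size (primes_le n.*2) <= size (primes_le X))%N.
  rewrite /primes_le; apply: uniq_leq_size; first exact/filter_uniq/iota_uniq.
  move=> p; rewrite !mem_filter !mem_index_iota => /and3P[-> -> h] /=.
  by apply: leq_trans h _; rewrite ltnS.
have h : (2 ^ n <= X ^ size (primes_le X))%N.
  apply: leq_trans (exp2_le_primes n0) _.
  apply: leq_trans (_ : X ^ size (primes_le n.*2) <= _)%N;  first by case: (size _) => // e; rewrite leq_exp2r.
  by rewrite leq_pexp2l.
have lnh : n%:R * ln 2 <= (size (primes_le X))%:R * ln X%:R :> R.
  rewrite !mulr_natl -!lnXn ?ltr0n // ler_ln ?posrE ?exprn_gt0 ?ltr0n //.
  by rewrite -[2]/(2%:R) -!natrX ler_nat.
have ln2 : 1 / 2 <= ln 2 :> R.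
  have := @le_ln1Dx R (- (1 / 2)) _; rewrite (_ : 1 + - (1 / 2) = 2^-1); last by lra.
  rewrite lnV ?posrE // => /(_ _)/wrap[|]; lra.
have Xn' : X%:R <= 2 * n%:R + 1 :> R by rewrite -natrM natr1 ler_nat mul2n.
have n1 : 1 <= n%:R :> R by rewrite ler1n.
have : n%:R * (1 / 2) <= n%:R * ln 2 :> R by rewrite ler_wpM2l.
set s : R := (size _)%:R in lnh *; move: lnh; rewrite [8 * _ * _]mulrAC -mulrA; lra.
Qed.

End Chebyshev.

(** * Counting pairwise inequivalent characters biased towards 1 on primes *)

Section BadCount.
Variable R : realType.
Local Notation C := R[i].
Local Notation re := (@complex.Re R).

(** [ntup] gives the coefficients of the [k]-th power of the prime sum, so the large sieve of length
    [X ^ k] bounds the sum of its [2k]-th moments. Each [d] contributes at least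
    [(size pr / 2) ^ (2 * k)], while [ntup_le] bounds the sum of squared coefficients by
    [k! * size pr ^ k]. *)
Lemma bad_count (ds pr : seq nat) (chi : nat -> nat -> C) (X D k : nat) :
  uniq ds -> (forall d, d \in ds -> (d <= D)%N /\ dchar d (chi d)) ->
  (forall d d', d \in ds -> d' \in ds -> d != d' ->
     nonprincipal (d * d') (fun n => (chi d n)^* * chi d' n)) ->
  uniq pr -> all prime pr -> (forall p, p \in pr -> (p <= X)%N) -> (0 < X)%N ->
  (forall d, d \in ds -> (size pr)%:R / 2 <= \sum_(p <- pr) re (chi d p)) ->
  (D ^ 3 <= X ^ k)%N -> (0 < size pr)%N ->
  (size ds * size pr ^ k <= 2 * k`! * 4 ^ k * X ^ k)%N.
Proof.
move=> uds hd hdd upr ppr hX X0 hre DX p0.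
have dsD : (size ds <= D)%N.
  rewrite -[leqRHS](size_iota 1); apply: uniq_leq_size => // d /hd[dD [d0 _ _ _]].
  by rewrite mem_iota d0 add1n ltnS.
have Xk0 : (0 < X ^ k)%N by rewrite expn_gt0 X0.
have := @large_sieve R ds chi (X ^ k)%N D (fun n => (ntup pr k n)%:R) uds Xk0 hd hdd.
set Pi := size pr in p0 *; set M := size ds in dsD *.
have A1 : \sum_(1 <= n < (X ^ k).+1) `|(ntup pr k n)%:R : C| ^+ 2 <= (k`! * Pi ^ k)%:R.
  apply: le_trans (_ : \sum_(1 <= n < (X ^ k).+1) (k`!)%:R * ((ntup pr k n)%:R * 1) <= _).
    apply: ler_sum => n _; rewrite normr_nat mulr1 expr2 ler_wpM2r // ler_nat.
    exact: ntup_le hX.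
  have e1 := @sum_ntup _ ppr C (fun _ => 1) X k (fun _ _ => esym (mulr1 1)) erefl X0 hX.
  by rewrite -mulr_sumr e1 big_const_seq iter_addr_0 count_predT natrM natrX.
have A2 : ((Pi%:R / 2) ^+ (2 * k)) *+ M <=
    \sum_(d <- ds) `|\sum_(1 <= n < (X ^ k).+1) (ntup pr k n)%:R * chi d n| ^+ 2 :> C.
  have -> : (Pi%:R / 2) ^+ (2 * k) *+ M = \sum_(d <- ds) ((Pi%:R / 2) ^+ 2) ^+ k :> C.
    by rewrite big_const_seq iter_addr_0 count_predT exprM.
  rewrite big_seq [leRHS]big_seq; apply: ler_sum => d dds; have [_ hc] := hd d dds.
  have [_ hM _ _] := hc.
  rewrite (@sum_ntup _ ppr C (chi d) X k hM (dchar1 hc) X0 hX) normrX -exprM mulnC exprM.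
  have h2 : Pi%:R / 2 <= `|\sum_(p <- pr) chi d p|.
    have -> : Pi%:R / 2 = (Pi%:R / 2 : R)%:C%C :> C.
      by rewrite rmorphM fmorphV /= !rmorph_nat.
    apply: le_trans (normc_ge_Re _); rewrite lecR re_sum.
    by apply: le_trans (hre d dds) (ler_norm _).
  by rewrite lerXn2r ?nnegrE ?exprn_ge0 ?divr_ge0 // lerXn2r ?nnegrE ?divr_ge0.
move=> A3; have := le_trans A2 (le_trans A3 (ler_wpM2l _ A1)).
move=> /(_ _)/wrap[//|]; rewrite -mulr_natl expr_div_n mulrA ler_pdivrMr ?exprn_gt0 //.
rewrite -!natrX -!natrM ler_nat => H.
(* Here [M * D ^ 2 <= D ^ 3 <= X ^ k], so the large sieve factor is at most [2 * X ^ k]. *)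
have H2 : (M * Pi ^ (2 * k) <= 2 * X ^ k * (k`! * Pi ^ k) * 2 ^ (2 * k))%N.
  apply: leq_trans H _; rewrite !leq_mul2r; apply/orP; right; apply/orP; right.
  rewrite mul2n -addnn leq_add2l; apply: leq_trans DX.
  by rewrite [(D ^ 3)%N]expnS leq_mul2r dsD orbT.
have Pk : (0 < Pi ^ k)%N by rewrite expn_gt0 p0.
rewrite -(leq_pmul2r Pk); move: H2; rewrite !expnM expnAC.
rewrite [in X in (M * X <= _)%N -> _]expnS expn1.
have -> : (2 ^ 2 = 4)%N by [].
by move: (Pi ^ k)%N (X ^ k)%N (4 ^ k)%N (k`!) => *; nia.
Qed.

End BadCount.

(** * Descent to the greatest common divisor of two moduli *)

Section Descent.
Variable R : realType.
Local Notation C := R[i].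
Local Notation re := (@complex.Re R).

Lemma coprime_primesP (m n : nat) : (forall p, prime p -> (p %| m)%N -> ~~ (p %| n)%N) ->
  coprime m n.
Proof.
move=> h; rewrite /coprime; apply/negPn/negP => g1.
have [g0|g0] := posnP (gcdn m n).
  have := h 2 isT; move/eqP: g0; rewrite -leqn0 leqNgt gcdn_gt0 negb_or -!leqNgt !leqn0.
  by case/andP=> /eqP-> /eqP->; rewrite dvdn0 => /(_ isT).
have g2 : (1 < gcdn m n)%N by rewrite ltn_neqAle eq_sym g1.
have := h _ (pdiv_prime g2) (dvdn_trans (pdiv_dvd _) (dvdn_gcdl _ _)).
by rewrite (dvdn_trans (pdiv_dvd _) (dvdn_gcdr _ _)).
Qed.

(** With [t] the product of the primes of [d] not dividing [n], every prime of [d] divides exactly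
    one of [n] and [g * t], hence not [n + g * t]. *)
Lemma unit_lift (g d n : nat) : (0 < d)%N -> coprime g n ->
  exists m, (m = n %[mod g])%N /\ coprime d m.
Proof.
move=> d0 gn; pose t := (\prod_(p <- primes d | ~~ (p %| n)%N) p)%N.
exists (n + g * t)%N; split; first by rewrite addnC mulnC modnMDl.
apply: coprime_primesP => p pp pd.
have pg : (p %| n)%N -> ~~ (p %| g)%N.
  move=> pn; apply/negP => pg; have := dvdn_gcd p g n; rewrite pg pn (eqP gn) /=.
  by rewrite dvdn1 => /eqP p1; rewrite p1 in pp.
have pt : (p %| t)%N = ~~ (p %| n)%N.
  rewrite /t Euclid_dvd_prod // big_has_cond; apply/hasP/idP.
    case=> q; rewrite mem_primes => /and3P[pq _ _] /andP[qn].
    by rewrite dvdn_prime2 // => /eqP ->.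
  move=> pn; exists p; last by rewrite /= pn dvdnn.
    by rewrite mem_primes pp d0 pd.
case: (boolP (p %| n)%N) => pn.
  by rewrite dvdn_addr // Euclid_dvdM // negb_or pg // pt pn.
by rewrite dvdn_addl // dvdn_mull // pt.
Qed.

Lemma crt_gcd (d d' m e : nat) : (0 < d)%N -> (0 < d')%N -> (m = e %[mod gcdn d d'])%N ->
  exists y, (y = m %[mod d])%N /\ (y = e %[mod d'])%N.
Proof.
move=> d0 d'0 me; set g := gcdn d d' in me *.
(* Adding [d' * m] keeps the class mod [d'] and ensures [m <= e2], so that the subtraction in [nat]
   is exact. *)
pose e2 := (e + d' * m)%N.
have me2 : (m <= e2)%N by rewrite /e2; nia.
have : (e2 == m %[mod g])%N.
  by rewrite /e2 -modnDmr -modnMml (eqP (dvdn_gcdr d d')) mul0n mod0n addn0 eq_sym; apply/eqP.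
rewrite eqn_mod_dvd // => /dvdnP[j ej].
case: (egcdnP d' d0) => u v euv _.
exists (m + u * j * d)%N; split; first by rewrite addnC modnMDl.
have -> : (m + u * j * d = v * j * d' + e2)%N.
  have : e2 = (m + j * g)%N by rewrite -ej subnKC.
  by move=> ->; rewrite mulnAC euv -/g; ring.
by rewrite modnMDl /e2 addnC mulnC modnMDl.
Qed.

(** The hypothesis says that [chi] and [chi'] agree on integers prime to both moduli. If [m] and
    [m'], prime to [d], agree mod the gcd, take [e] in their class and prime to [d']: an integer
    that is [m] mod [d] and [e] mod [d'] shows [chi m = chi' e], and likewise for [m']. So [chi]
    depends only on the class mod the gcd. *)
Lemma dchar_gcd d d' (chi chi' : nat -> C) : dchar d chi -> dchar d' chi' ->
  ~ nonprincipal (d * d') (fun n => (chi n)^* * chi' n) ->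
  exists psi, dchar (gcdn d d') psi /\ forall n, coprime d n -> psi n = chi n.
Proof.
move=> hc hc' nn; set g := gcdn d d'.
have [d0 M P N] := hc; have [d'0 M' P' N'] := hc'.
have gd : (g %| d)%N := dvdn_gcdl _ _; have gd' : (g %| d')%N := dvdn_gcdr _ _.
have agree n : coprime d n -> coprime d' n -> chi n = chi' n.
  move=> dn d'n; apply: contrapT => ne; apply: nn; exists n; first by rewrite coprimeMl dn.
  apply/eqP => e; apply: ne.
  have : chi n * ((chi n)^* * chi' n) = chi n by rewrite e mulr1.
  by rewrite mulrA -normCK N dn expr1n mul1r => ->.
have key m m' : (m = m' %[mod g])%N -> coprime d m -> coprime d m' -> chi m = chi m'.
  move=> mm' dm dm'.
  have [e [em d'e]] := unit_lift d'0 (coprime_dvdl gd dm).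
  have T x : (x = e %[mod g])%N -> coprime d x -> chi x = chi' e.
    move=> xe dx; have [y [yx ye]] := crt_gcd d0 d'0 xe.
    rewrite -(P _ _ yx) -(P' _ _ ye); apply: agree.
      by rewrite -coprime_modr yx coprime_modr.
    by rewrite -coprime_modr ye coprime_modr.
  by rewrite (T m) // (T m') // -mm'.
have /choice[lift hl] : forall n, exists m, coprime g n -> (m = n %[mod g])%N /\ coprime d m.
  move=> n.
  case: (boolP (coprime g n)) => gn; last by exists 0%N.
  by have [m hm] := unit_lift d0 gn; exists m.
pose psi n := if coprime g n then chi (lift n) else 0.
have psiE n x : coprime g n -> coprime d x -> (x = n %[mod g])%N -> psi n = chi x.
  move=> gn dx xn; rewrite /psi gn; have [l1 l2] := hl n gn.
  by apply: key => //; rewrite l1.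
exists psi; split; last by move=> n dn; apply: psiE => //; apply: coprime_dvdl gd dn.
split.
- by rewrite gcdn_gt0 d0.
- move=> m n; case: (boolP (coprime g m)) => gm; last first.
    by rewrite {1 2}/psi coprimeMr (negbTE gm) /= mul0r.
  case: (boolP (coprime g n)) => gn; last first.
    by rewrite {1 3}/psi coprimeMr (negbTE gn) andbF mulr0.
  have [l1 l2] := hl m gm; have [l3 l4] := hl n gn.
  rewrite (psiE _ (lift m * lift n)%N) ?coprimeMr ?gm ?l2 //.
    by rewrite M /psi gm gn.
  by rewrite -modnMml l1 modnMml -modnMmr l3 modnMmr.
- move=> m n mn; have gg : coprime g m = coprime g n.
    by rewrite -coprime_modr mn coprime_modr.
  case: (boolP (coprime g m)) => gm; last by rewrite /psi -gg (negbTE gm).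
  have gn : coprime g n by rewrite -gg.
  have [l1 l2] := hl m gm.
  by rewrite {1}/psi gm (psiE n (lift m)) // l1.
- move=> n; rewrite /psi; case: ifP => gn; last by rewrite normr0.
  by have [_ l2] := hl n gn; rewrite N l2.
Qed.

Variables (z X : nat) (c0 : R).

Definition isbad (d : nat) : Prop :=
  exists chi, [/\ dchar d chi, nonprincipal d chi & Hsum z X d chi < c0].

Definition minbad (d : nat) : Prop :=
  isbad d /\ forall e, (e %| d)%N -> (e < d)%N -> ~ isbad e.

Lemma isbad_min d : isbad d -> exists2 e, (e %| d)%N & minbad e.
Proof.
elim/ltn_ind: d => d IH bd.
have [h|h] := pselect (minbad d); first by exists d.
have [e [ed lt be]] : exists e, [/\ (e %| d)%N, (e < d)%N & isbad e].
  apply: contrapT => hn; apply: h; split=> // e ed lt be; apply: hn; by exists e.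
by have [f fe mf] := IH e lt be; exists f => //; apply: dvdn_trans ed.
Qed.

(** Otherwise [chi] descends to the gcd of [d] and [d']. Passing to a divisor does not increase
    [hval], so the gcd is bad as well, and minimality forces it to equal both [d] and [d']. *)
Lemma minbad_nonprincipal d d' (chi chi' : nat -> C) :
  minbad d -> minbad d' -> d != d' ->
  dchar d chi -> nonprincipal d chi -> Hsum z X d chi < c0 -> dchar d' chi' ->
  nonprincipal (d * d') (fun n => (chi n)^* * chi' n).
Proof.
move=> [_ md] [_ md'] dd' hc [n dn cn] hH hc'; apply: contrapT => nn.
have [psi [hp pE]] := dchar_gcd hc hc' nn.
set g := gcdn d d' in hp.
have [d0 _ _ _] := hc; have [d'0 _ _ _] := hc'.
have gd : (g %| d)%N := dvdn_gcdl _ _; have gd' : (g %| d')%N := dvdn_gcdr _ _.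
have bg : isbad g.
  exists psi; split=> //.
    by exists n; rewrite ?pE //; apply: coprime_dvdl gd dn.
  apply: le_lt_trans hH; apply: ler_sum => p pp.
  rewrite ler_wpM2r ?invr_ge0 // /hval; case: (boolP (p %| d)%N) => pd.
    case: ifP => // _; have := re_dchar_le1 p hp; rewrite ler_norml => /andP[h _]; lra.
  have -> : (p %| g)%N = false by apply: contraNF pd => /dvdn_trans; apply.
  by rewrite pE // coprime_sym prime_coprime.
have := dvdn_leq d0 gd; rewrite leq_eqVlt => /orP[/eqP e1|lt]; last exact: md gd lt bg.
have := dvdn_leq d'0 gd'; rewrite leq_eqVlt => /orP[/eqP e2|lt]; last exact: md' gd' lt bg.
by move: dd'; rewrite -e1 -e2 eqxx.
Qed.

End Descent.

(** * Sparsity of the minimal bad moduli *)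

Section Sparse.

Lemma fact_le_exp (k : nat) : (k`! <= k ^ k)%N.
Proof.
elim: k => // k IH; rewrite factS expnS leq_mul2l; apply/orP; right.
by apply: leq_trans IH _; case: k => // k; rewrite leq_exp2r.
Qed.

(** The bound for [M] becomes [(2 * 4 l * 4 * 16 lam) ^ k = (512 * lam * l) ^ k <= l ^ (2 * k)].
    With [k = t + 1] this yields [M ^ 16 <= l ^ (32 * (t + 1)) <= l ^ a * X ^ t <= D * D ^ 3], which
    is where [32 <= a] is spent. *)
Lemma count_pow_le (l a B M D Pi lam : nat) :
  (0 < lam)%N -> (512 * lam <= l)%N -> (32 <= a)%N -> (0 < B)%N ->
  ((l ^ a) ^ B <= 16 * lam * Pi)%N -> (l ^ a < D)%N -> (D <= 3 ^ l)%N ->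
  (forall k, D ^ 3 <= ((l ^ a) ^ B) ^ k ->
     M * Pi ^ k <= 2 * k`! * 4 ^ k * ((l ^ a) ^ B) ^ k)%N ->
  (M ^ 4 <= D)%N.
Proof.
move=> lam0 laml a32 B0; set X := ((l ^ a) ^ B)%N => XPi zD Dl H.
have l3 : (3 <= l)%N by lia.
have l0 : (0 < l)%N by lia.
have X3 : (3 <= X)%N.
  rewrite /X -expnM (leq_trans l3) // -[leqLHS]expn1 leq_pexp2l // muln_gt0 B0 andbT.
  by lia.
have X1 : (1 < X)%N by apply: leq_trans X3.
have D0 : (0 < D)%N by apply: leq_ltn_trans zD.
have D30 : (0 < D ^ 3)%N by rewrite expn_gt0 D0.
(* The moment is the least [k] with [D ^ 3 < X ^ k]. Since [3 ^ t <= X ^ t <= D ^ 3 <= 3 ^ (3 * l)],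
   it is at most [4 * l], so [k! <= (4 * l) ^ k]. *)
have := trunc_log_bounds X1 D30; set t := trunc_log X (D ^ 3) => /= /andP[tD Dt].
have tl : (t <= 3 * l)%N.
  rewrite -(leq_exp2l _ _ (isT : 1 < 3)%N) mulnC expnM.
  apply: leq_trans (_ : D ^ 3 <= _)%N; last by rewrite leq_exp2r.
  by apply: leq_trans tD; case: (t) => // t'; rewrite leq_exp2r.
have Pi0 : (0 < Pi)%N by move: XPi; case: (Pi) => //; rewrite muln0; lia.
have M1 : (M <= l ^ (2 * t.+1))%N.
  have Pk : (0 < Pi ^ t.+1)%N by rewrite expn_gt0 Pi0.
  rewrite -(leq_pmul2r Pk); apply: leq_trans (H t.+1 (ltnW Dt)) _.
  apply: leq_trans (_ : 2 ^ t.+1 * (4 * l) ^ t.+1 * 4 ^ t.+1 * (16 * lam * Pi) ^ t.+1 <= _)%N.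
    rewrite !leq_mul // ?leq_exp2r //; first by rewrite -[leqLHS]expn1 leq_pexp2l.
    apply: leq_trans (fact_le_exp _) _; rewrite leq_exp2r //; lia.
  rewrite -!expnMn expnM -expnMn leq_exp2r //.
  by rewrite -mulnn; nia.
apply: leq_trans (_ : (l ^ (2 * t.+1)) ^ 4 <= _)%N; first by rewrite leq_exp2r.
rewrite -(leq_exp2r _ _ (isT : 0 < 4)%N) -!expnM.
apply: leq_trans (_ : l ^ a * X ^ t <= _)%N; last first.
  by rewrite [(D ^ 4)%N]expnS leq_mul // ltnW.
rewrite /X -!expnM -expnD leq_pexp2l //.
have : (a * B * t >= 32 * t)%N by rewrite leq_mul2r; apply/orP; right; rewrite (leq_trans a32) // leq_pmulr.
lia.
Qed.

Variable R : realType.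

(** For the [k]-th element [d] of [P], [k ^ 4 <= d] and [w ^ 2 <= z < d] multiply to
    [k ^ 2 * w <= d], so the sum is at most that of [1 / k ^ 2], divided by [w]. The induction
    carries the telescoped bound [2 - 1 / c n]. *)
Lemma sum_inv_sparse (P : pred nat) (z w Q : nat) : (0 < w)%N -> (w ^ 2 <= z)%N ->
  (forall d, P d -> z < d)%N -> (forall D, (D <= Q)%N -> (count P (index_iota 1 D.+1) ^ 4 <= D)%N) ->
  \sum_(1 <= d < Q.+1 | P d) d%:R^-1 <= 2 / w%:R :> R.
Proof.
move=> w0 wz hP hc.
have w0' : 0 < w%:R :> R by rewrite ltr0n.
pose c n := count P (index_iota 1 n.+1).
suff H n : (n <= Q)%N -> \sum_(1 <= d < n.+1 | P d) d%:R^-1 <=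
    (if c n is _.+1 then 2 - (c n)%:R^-1 else 0) / w%:R :> R.
  apply: le_trans (H Q (leqnn _)) _; rewrite ler_wpM2r ?invr_ge0 //.
  by case: (c Q) => // k; rewrite gerBl invr_ge0.
elim: n => [|n IH] nQ; first by rewrite big_geq // /c /= mul0r.
have cS : c n.+1 = (c n + P n.+1)%N.
  rewrite /c.
  have -> : index_iota 1 n.+2 = rcons (index_iota 1 n.+1) n.+1.
    by rewrite /index_iota !subSS !subn0; have := iotaD 1 n 1; rewrite addn1 add1n => ->; rewrite cats1.
  by rewrite -cats1 count_cat /= addn0.
rewrite big_mkcond big_nat_recr //= -big_mkcond /=.
have IH' := IH (ltnW nQ); case: ifP cS => [Pn|Pn]; last by rewrite addn0 addr0 => ->.
rewrite addn1 => cS; rewrite cS.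
apply: le_trans (lerD IH' (lexx _)) _.
have h4 := hc n.+1 nQ; rewrite -/(c n.+1) cS in h4.
have hz := hP _ Pn.
set k := (c n).+1 in h4 *.
have kw : (k ^ 2 * w <= n.+1)%N.
  rewrite -leq_sqr expnMn -expnM.
  by rewrite -[leqRHS]mulnn leq_mul // (leq_trans wz) // ltnW.
have kw' : (n.+1%:R)^-1 <= (k%:R ^+ 2)^-1 / w%:R :> R.
  rewrite -invfM lef_pV2 ?posrE ?mulr_gt0 ?exprn_gt0 ?ltr0n //.
  by rewrite -natrX -natrM ler_nat.
apply: le_trans (lerD (lexx _) kw') _.
rewrite -mulrDl ler_wpM2r ?invr_ge0 // /k.
case: (c n) => [|j]; first by rewrite add0r expr1n !invr1; lra.
set x : R := j.+1%:R; have x0 : 0 < x by rewrite ltr0n.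
have -> : j.+2%:R = x + 1 :> R by rewrite -natr1.
rewrite -subr_ge0.
have -> : 2 - (x + 1)^-1 - (2 - x^-1 + ((x + 1) ^+ 2)^-1) = (x * (x + 1) ^+ 2)^-1.
  by field; rewrite !gt_eqF //; lra.
by rewrite invr_ge0 mulr_ge0 ?sqr_ge0 // ltW.
Qed.

Lemma sum_minbad (l a B Q lam w : nat) (c0 : R) :
  let z := (l ^ a)%N in let X := (z ^ B)%N in
  let Pi := size [seq p <- index_iota z.+1 X.+1 | prime p] in
  (0 < lam)%N -> (512 * lam <= l)%N -> (32 <= a)%N -> (0 < B)%N ->
  (X <= 16 * lam * Pi)%N -> X%:R * c0 <= Pi%:R / 2 ->
  (Q <= 3 ^ l)%N -> (0 < w)%N -> (w ^ 2 <= z)%N ->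
  (forall d, isbad z X c0 d -> (z < d)%N) ->
  \sum_(1 <= d < Q.+1 | `[<minbad z X c0 d>]) d%:R^-1 <= 2 / w%:R :> R.
Proof.
move=> z X Pi lam0 laml a32 B0 XPi Xc0 Ql w0 wz hsmall.
apply: (sum_inv_sparse w0 wz); first by move=> d /asboolP[/hsmall].
move=> D DQ; set ds := [seq d <- index_iota 1 D.+1 | `[<minbad z X c0 d>]].
rewrite -size_filter -/ds.
have [Dz|zD] := leqP D z.
  have -> : ds = [::]; last by [].
  apply/eqP; rewrite -[_ == _]negbK -has_filter; apply/hasPn => d.
  rewrite mem_index_iota => /andP[_ dD]; apply/negP => /asboolP[/hsmall].
  by rewrite ltnNge (leq_trans _ Dz).
have l0 : (0 < l)%N by lia.
have z0 : (0 < z)%N by rewrite expn_gt0 l0.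
have X0 : (0 < X)%N by rewrite expn_gt0 z0.
apply: (count_pow_le lam0 laml a32 B0 XPi zD (leq_trans DQ Ql)) => k Dk.
have /choice[chi hchi] : forall d, exists chi, minbad z X c0 d ->
    [/\ dchar d chi, nonprincipal d chi & Hsum z X d chi < c0].
  move=> d; have [[[chi hchi] _]|h] := pselect (minbad z X c0 d); first by exists chi.
  by exists (fun _ => 0).
have dsP d : d \in ds -> minbad z X c0 d /\ (d <= D)%N.
  by rewrite mem_filter mem_index_iota ltnS => /andP[/asboolP h /andP[_ ->]].
have Pi0 : (0 < Pi)%N by move: XPi; case: (Pi) => //; rewrite muln0; lia.
apply: (@bad_count R ds _ chi X D k) => //.
- exact/filter_uniq/iota_uniq.
- by move=> d /dsP[m dD]; split=> //; case: (hchi d m).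
- move=> d d' /dsP[m _] /dsP[m' _] dd'.
  have [h1 h2 h3] := hchi d m; have [h4 _ _] := hchi d' m'.
  exact: minbad_nonprincipal m m' dd' h1 h2 h3 h4.
- exact/filter_uniq/iota_uniq.
- exact: filter_all.
- by move=> p; rewrite mem_filter mem_index_iota ltnS => /and3P[].
move=> d /dsP[m _]; have [h1 _ h3] := hchi d m.
rewrite big_filter.
(* As [p <= X], the sum of [1 - re (chi p)] is at most [X * Hsum < X * c0 <= Pi / 2]: a bad
   character has the bias that [bad_count] asks for. *)
have e1 : \sum_(z.+1 <= p < X.+1 | prime p) (1 - complex.Re (chi d p)) <= X%:R * Hsum z X d (chi d).
  rewrite /Hsum mulr_sumr big_nat_cond [leRHS]big_nat_cond.
  apply: ler_sum => p /andP[/andP[zp pX] pp]; have p0 : 0 < p%:R :> R by rewrite ltr0n prime_gt0.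
  apply: le_trans (hval_ge p h1) _.
  rewrite mulrCA ler_peMr //; last by rewrite ler_pdivlMr // mul1r ler_nat.
  exact: le_trans (dist1_ge0 p h1) (hval_ge p h1).
have e2 : X%:R * Hsum z X d (chi d) <= Pi%:R / 2.
  by apply: le_trans Xc0; rewrite ler_wpM2l // ltW.
move: e1; rewrite sumrB.
have -> : \sum_(z.+1 <= p < X.+1 | prime p) 1 = Pi%:R :> R.
  by rewrite big_const_seq iter_addr_0 -size_filter.
move: e2; set s := \sum_(_ <= _ < _ | _) _; lra.
Qed.

End Sparse.

(** * The characters of a given modulus *)

Section Dual.
Variable R : realType.
Local Notation C := R[i].

Lemma primitive_root_exists (F : numClosedFieldType) (n : nat) : (0 < n)%N ->
  exists z : F, n.-primitive_root z.
Proof.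
pose p : {poly F} := 'X^n - 1; have [r Dp] := closed_field_poly_normal p.
move=> n0; rewrite (monicP _) ?monicXnsubC // scale1r in Dp.
have rn1 : all n.-unity_root r by apply/allP=> z; rewrite -root_prod_XsubC -Dp.
have sz_r : (n < (size r).+1)%N.
  by rewrite -(size_prod_XsubC r id) -Dp size_XnsubC.
have [|z] := hasP (has_prim_root n0 rn1 _ sz_r); last by exists z.
by rewrite -separable_prod_XsubC -Dp separable_Xn_sub_1 // pnatr_eq0 -lt0n.
Qed.

(* Characters of finite groups take their values in [algC] in the library; being
   roots of unity, these values can be moved to [R[i]]. *)
Lemma root_hom_transfer (N : nat) (I : finType) (chi : I -> nat -> algC) (q : nat) :
  (0 < N)%N -> (forall i n, coprime q n -> chi i n ^+ N = 1) ->
  exists psi : I -> nat -> C, forall i,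
  [/\ forall n, coprime q n -> `|psi i n| = 1,
      forall n, ~~ coprime q n -> psi i n = 0,
      forall n, coprime q n -> (psi i n == 1) = (chi i n == 1)
    & forall j k a b c, coprime q a -> coprime q b -> coprime q c ->
       chi i a = chi j b * chi k c -> psi i a = psi j b * psi k c].
Proof.
move=> N0 hN; have [w pw] := C_prim_root_exists N0.
have [zt pz] := @primitive_root_exists C N N0.
have /choice[e he] : forall x : I * nat, exists k, coprime q x.2 -> chi x.1 x.2 = w ^+ k.
  case=> i n /=; case: (boolP (coprime q n)) => qn; last by exists 0%N.
  by have [k hk] := prim_rootP pw (hN i n qn); exists k.
exists (fun i n => if coprime q n then zt ^+ e (i, n) else 0) => i.
have tr j k : (zt ^+ j == zt ^+ k) = (w ^+ j == w ^+ k).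
  by rewrite (eq_prim_root_expr pw) (eq_prim_root_expr pz).
split.
- move=> n ->; apply/eqP; rewrite -(@pexpr_eq1 _ _ N) // -normrX -exprM mulnC exprM.
  by rewrite (prim_expr_order pz) expr1n normr1.
- by move=> n /negbTE ->.
- by move=> n qn; rewrite qn (he (i, n) qn) -(expr0 zt) -(expr0 w) tr.
move=> j k a b c qa qb qc; rewrite qa qb qc.
have := he (i, a) qa; have := he (j, b) qb; have := he (k, c) qc => /= -> -> ->.
by rewrite -!exprD => /eqP; rewrite -tr => /eqP.
Qed.

Lemma dual_chars (q : nat) : (0 < q)%N -> exists (m : nat) (chi : nat -> nat -> C),
  [/\ (m < q)%N, forall i, (i <= m)%N -> dchar q (chi i),
      forall n, coprime q n -> chi 0%N n = 1,
      forall i, (0 < i <= m)%N -> nonprincipal q (chi i)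
    & forall n, coprime q n -> (n != 1 %[mod q])%N -> \sum_(i < m.+1) chi i n = 0].
Proof.
case: q => // -[|q'] _.
  (* Modulus 1 is treated apart because ['Z_1] has two elements; its only character is constant. *)
  exists 0%N, (fun _ _ => 1); split=> //; first by move=> i _; split=> // *; rewrite ?mul1r // normr1 /coprime gcd1n.
    by case.
  by move=> n _; rewrite !modn1.
set q := q'.+2; have q1 : (1 < q)%N by [].
pose G := [set: {unit 'Z_q}]%G.
pose N := #|G|.
have N0 : (0 < N)%N := cardG_gt0 _.
have Nq : (N <= q)%N.
  rewrite /N cardsT (leq_trans (leq_card _ (@val_inj _ _ {unit 'Z_q}))) //.
  by rewrite card_ord.
have abG : abelian G := units_Zp_abelian q.
have lin i : 'chi[G]_i \is a linear_char := char_abelianP _ abG i.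
have mN : (pred_Nirr G).+1 = N by rewrite NirrE; apply/eqP; rewrite -card_classes_abelian.
pose u (n : nat) : {unit 'Z_q} := insubd (1%g : {unit 'Z_q}) (n%:R : 'Z_q).
have uE n : coprime q n -> val (u n) = n%:R.
  by move=> qn; apply: insubdK; rewrite -topredE /= unitZpE.
have uM m n : coprime q m -> coprime q n -> u (m * n)%N = (u m * u n)%g.
  move=> qm qn; apply: val_inj; rewrite uE ?coprimeMr ?qm //= natrM.
  by rewrite -!uE.
have uP m n : (m = n %[mod q])%N -> u m = u n.
  move=> mn; rewrite /u; have -> // : m%:R = n%:R :> 'Z_q.
  by apply/eqP; rewrite -val_eqE /= !val_Zp_nat //; apply/eqP.
have u1 n : coprime q n -> (n = 1 %[mod q])%N <-> u n = 1%g.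
  move=> qn; split=> [/uP->|e]; first by apply: val_inj; rewrite uE ?coprimen1.
  have := uE n qn; rewrite e => /(congr1 val) /=; rewrite val_Zp_nat // => <-.
have uG n : u n \in G by rewrite inE.
have hN i n : coprime q n -> 'chi[G]_i (u n) ^+ N = 1.
  by move=> _; rewrite -lin_charX // expg_cardG // lin_char1.
have [psi hpsi] := root_hom_transfer (q := q) N0 hN.
have psiM i m n : psi i (m * n)%N = psi i m * psi i n.
  have [_ z0 _ tr] := hpsi i.
  case: (boolP (coprime q m)) => qm; last by rewrite (z0 m qm) mul0r z0 // coprimeMr (negbTE qm).
  case: (boolP (coprime q n)) => qn; last by rewrite (z0 n qn) mulr0 z0 // coprimeMr (negbTE qn) andbF.
  by apply: tr => //; rewrite ?coprimeMr ?qm // uM // lin_charM.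
have hc i : dchar q (psi i).
  have [n1 z0 _ tr] := hpsi i; split=> //.
    move=> m n mn; have e : coprime q m = coprime q n by rewrite -coprime_modr mn coprime_modr.
    case: (boolP (coprime q m)) => qm; last by rewrite !z0 // -e.
    rewrite -[RHS]mul1r -(mulr1 (psi i n)) mul1r.
    have p1 : psi i 1%N = 1.
      by have [_ _ h _] := hpsi i; apply/eqP; rewrite h ?coprimen1 // (u1 1%N _).1 ?coprimen1 // lin_char1.
    rewrite -p1; apply: tr; rewrite ?coprimen1 -?e //.
    by rewrite (uP _ _ mn) (u1 1%N _).1 ?coprimen1 // lin_char1 // mulr1.
  by move=> n; case: (boolP (coprime q n)) => qn; [rewrite n1|rewrite z0 // normr0].
exists (pred_Nirr G), (fun i n => psi (inord i) n); split.
- by rewrite -ltnS mN ltnS.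
- by move=> i _; apply: hc.
- move=> n qn; have [_ _ h _] := hpsi (inord 0); apply/eqP; rewrite h //.
  have -> : inord 0 = 0 :> Iirr G by apply/val_inj; rewrite /= inordK.
  by rewrite irr0 cfun1E uG.
- move=> i /andP[i0 im]; apply: contrapT => hn.
  have : 'chi[G]_(inord i) = 'chi_0.
    apply/cfun_inP => g _; rewrite irr0 cfun1E inE /=.
    have eg : g = u (val (val g)).
      apply: val_inj; rewrite uE ?natr_Zp //.
      by rewrite -(unitZpE _ q1) natr_Zp; apply: (valP g).
    have qg : coprime q (val (val g)) by rewrite -(unitZpE _ q1) natr_Zp; apply: (valP g).
    rewrite eg; apply/eqP; have [_ _ h _] := hpsi (inord i); rewrite -h //.
    by apply/negPn/negP => ne; apply: hn; exists (val (val g)).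
  move/irr_inj/(congr1 val) => /=; rewrite inordK ?ltnS // => e.
  by rewrite e in i0.
move=> n qn n1.
(* If all characters were [1] at [u n], the second orthogonality relation for [u n] and [1] would
   make their number zero. *)
have [j hj] : exists j : Iirr G, 'chi_j (u n) != 1.
  apply: contrapT => hn; have := @second_orthogonality_relation _ G (u n) 1%g (group1 G).
  rewrite class1G inE.
  have -> : (u n == 1%g) = false.
    by apply/eqP => e; case/eqP: n1; apply/(u1 n qn).
  rewrite mulr0n (eq_bigr (fun _ => 1)); last first.
    move=> i _; rewrite lin_char1 // conjC1 mulr1; apply/eqP/negPn/negP => h.
    by apply: hn; exists i.
  by rewrite sumr_const card_ord => /eqP; rewrite pnatr_eq0.
(* Multiplication by ['chi_j] permutes the characters, so the sum equals itself times [psi j n], a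
   number other than [1], and must vanish. *)
pose s (i : Iirr G) := cfIirr ('chi_i * 'chi_j).
have sE i : 'chi_(s i) = 'chi_i * 'chi_j by rewrite cfIirrE // mul_lin_irr // mem_irr.
have sinj : injective s.
  move=> i k e; apply: irr_inj; apply/cfun_inP => g gG.
  have := sE i; rewrite e sE => /(congr1 (fun f : 'CF(G) => f g)).
  by rewrite !cfunE => /mulIf -> //; rewrite lin_char_neq0.
have -> : \sum_(i < (pred_Nirr G).+1) psi (inord i) n = \sum_(i : Iirr G) psi i n.
  by apply: eq_bigr => i _; rewrite inord_val.
have e : \sum_(i : Iirr G) psi i n = \sum_(i : Iirr G) psi i n * psi j n.
  rewrite (reindex_inj sinj) /=; apply: eq_bigr => i _.
  have [_ _ _ tr] := hpsi (s i); apply: tr => //.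
  by rewrite sE cfunE.
have : (\sum_(i : Iirr G) psi i n) * (1 - psi j n) = 0.
  by rewrite mulrBr mulr1 -mulr_suml in e *; rewrite {1}e subrr.
move/eqP; rewrite mulf_eq0 subr_eq0 => /orP[/eqP//|]; rewrite eq_sym.
by have [_ _ h _] := hpsi j; rewrite h // (negbTE hj).
Qed.

End Dual.

(** * Detection of subset products by characters *)

Section Fourier.
Variable R : realType.
Local Notation C := R[i].
Local Notation re := (@complex.Re R).

Lemma norm1D_sqr d (chi : nat -> C) p : dchar d chi -> prime p -> ~~ (p %| d)%N ->
  `|1 + chi p| ^+ 2 = (4 * (1 - hval d chi p / 2))%:C%C.
Proof.
move=> hc pp pd; have [_ _ _ N] := hc.
have n1 : `|chi p| = 1 by rewrite N coprime_sym prime_coprime // pd.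
have h : re (chi p) ^+ 2 + complex.Im (chi p) ^+ 2 = 1.
  by have := add_Re2_Im2 (chi p); rewrite n1 expr1n => H; exact: (congr1 re H).
rewrite -add_Re2_Im2 /hval (negbTE pd); congr (_%:C)%C.
by move: h; case: (chi p) => a b /= h; rewrite add0r -[b ^+ 2](addKr (a ^+ 2)) h; field.
Qed.

Lemma dchar_prod d (chi : nat -> C) (I : Type) (s : seq I) (F : I -> nat) : dchar d chi ->
  chi (\prod_(i <- s) F i)%N = \prod_(i <- s) chi (F i).
Proof.
by move=> hc; have [_ M _ _] := hc; apply: (big_morph chi M); apply: dchar1 hc.
Qed.

(** If a unit with inverse [y] is missed, no subset product times [y] is [1], so the character sum
    over all subsets vanishes. Its principal term is [2 ^ N], while each of the other [m < q] terms
    is at most [2 ^ N / q], because its square is at most [4 ^ N * e] and [e * q ^ 2 < 1]: a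
    contradiction. *)
Lemma subset_products_units (P : {fset nat}) (q m : nat) (chi : nat -> nat -> C) (e : R) :
  (0 < q)%N -> (forall p, p \in P -> prime p /\ ~~ (p %| q)%N) ->
  (m < q)%N -> (forall i, (i <= m)%N -> dchar q (chi i)) ->
  (forall n, coprime q n -> chi 0%N n = 1) ->
  (forall n, coprime q n -> (n != 1 %[mod q])%N -> \sum_(i < m.+1) chi i n = 0) ->
  (forall i, (0 < i <= m)%N -> \prod_(p <- P) (1 - hval q (chi i) p / 2) <= e) ->
  e * q%:R ^+ 2 < 1 ->
  subset_products_mod P q = residue_units q.
Proof.
case: q => // q _ hP mq hc h0 hsum he eq1.
have cP (a : {ffun P -> bool}) : coprime q.+1 (\prod_(p : P) val p ^ a p)%N.
  apply: (big_ind (fun n => coprime q.+1 n)) => [|x y cx cy|p _]; rewrite ?coprimen1 //.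
    by rewrite coprimeMr cx.
  have [pp pq] := hP _ (valP p); apply: coprimeXr.
  by rewrite coprime_sym prime_coprime.
apply/setP => x; apply/idP/idP.
  case/imsetP => a _ ->; rewrite residue_units_coprime //.
  by rewrite /= coprime_modr.
move=> hx; have := hx; rewrite inE => /existsP[y /eqP xy].
have xy1 : (x * y = 1 %[mod q.+1])%N by have := congr1 val xy.
have cy : coprime q.+1 y.
  have : coprime q.+1 (x * y) by rewrite -coprime_modr xy1 coprime_modr coprimen1.
  by rewrite coprimeMr => /andP[].
apply: contrapT => hn.
have ne (a : {ffun P -> bool}) : (y * \prod_(p : P) val p ^ a p != 1 %[mod q.+1])%N.
  apply/eqP => ya; apply: hn; apply/imsetP; exists a => //.
  set A := (\prod_(p : P) _)%N in ya *.
  have : (x = A %[mod q.+1])%N.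
    by rewrite -[in LHS](muln1 x) -modnMmr -ya modnMmr mulnA -modnMml xy1 modnMml mul1n.
  by move=> xA; apply: val_inj => /=; rewrite -xA modn_small //; apply: ltn_ord.
set N := #|{: P}|.
have Z : \sum_(a : {ffun P -> bool}) \sum_(i < m.+1) chi i (y * \prod_(p : P) val p ^ a p)%N = 0.
  by rewrite big1 // => a _; apply: hsum; rewrite ?ne // coprimeMr cy cP.
have E : \sum_(i < m.+1) chi i y * \prod_(p : P) (1 + chi i (val p)) = 0.
  rewrite -[RHS]Z exchange_big /=; apply: eq_bigr => i _.
  have hi := hc i (ltn_ord i); have [_ M _ _] := hi.
  under [RHS]eq_bigr => a _ do rewrite M (dchar_prod _ _ hi).
  rewrite -mulr_sumr; congr (_ * _).
  transitivity (\prod_(p : P) \sum_(b : bool) chi i (val p ^ b)%N).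
    by apply: eq_bigr => p _; rewrite big_bool /= expn1 expn0 (dchar1 hi) addrC.
  by rewrite bigA_distr_bigA.
have q0' : 0 < q.+1%:R :> C by rewrite ltr0n.
have bound (i : 'I_m) : `|chi i.+1 y * \prod_(p : P) (1 + chi i.+1 (val p))| <= 2 ^+ N / q.+1%:R.
  have hi := hc i.+1 (ltn_ord i).
  rewrite normrM; apply: le_trans (_ : `|\prod_(p : P) (1 + chi i.+1 (val p))| <= _).
    by rewrite ler_piMl //; apply: dchar_norm_le1 hi.
  rewrite ler_pdivlMr //.
  rewrite -(@ler_pXn2r _ 2) ?nnegrE ?mulr_ge0 ?exprn_ge0 //.
  rewrite exprMn normr_prod -prodrXl.
  have -> : \prod_(p : P) `|1 + chi i.+1 (val p)| ^+ 2 =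
      (4 ^+ N * \prod_(p <- P) (1 - hval q.+1 (chi i.+1) p / 2))%:C%C.
    rewrite big_seq_fsetE /= -[N]/(#|{: P}|) -prodr_const -big_split /=.
    rewrite rmorph_prod; apply: eq_bigr => p _.
    by have [pp pq] := hP _ (valP p); rewrite (norm1D_sqr hi).
  have -> : q.+1%:R ^+ 2 = (q.+1%:R ^+ 2)%:C%C :> C by rewrite rmorphXn rmorph_nat.
  have -> : (2 ^+ N) ^+ 2 = (4 ^+ N)%:C%C :> C.
    by rewrite -exprM mulnC exprM rmorphXn /= rmorph_nat -natrX.
  rewrite -rmorphM lecR -mulrA ler_piMr ?exprn_ge0 //.
  apply: le_trans (ltW eq1); rewrite ler_wpM2r ?exprn_ge0 //.
  by apply: he; rewrite /= ltn_ord.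
have : 2 ^+ N <= \sum_(i < m) 2 ^+ N / q.+1%:R :> C.
  apply: le_trans (_ : `|\sum_(i < m) chi i.+1 y * \prod_(p : P) (1 + chi i.+1 (val p))| <= _).
    move: E; rewrite big_ord_recl /= h0 // mul1r => /eqP; rewrite addrC addr_eq0 => /eqP ->.
    rewrite normrN normr_prod (eq_bigr (fun _ => 2)) ?prodr_const //.
    move=> p _; have [pp pq] := hP _ (valP p).
    rewrite h0; last by rewrite coprime_sym prime_coprime.
    by rewrite -[1 + 1]/(2%:R) normr_nat.
  by apply: le_trans (ler_norm_sum _ _ _) _; apply: ler_sum => i _; apply: bound.
rewrite sumr_const card_ord -[_ *+ m]mulr_natl mulrCA ler_pMr ?exprn_gt0 //.
by rewrite ler_pdivlMr // mul1r ler_nat leqNgt mq.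
Qed.

End Fourier.

(** * Choice of the set of primes *)

Section Selection.
Variable R : realType.
Local Notation C := R[i].
Local Notation re := (@complex.Re R).

(* Method of conditional expectations for the random subset of [s] containing
   each [p] independently with probability [tau p]. *)
Lemma select_subset (T : Type) (I : seq T) (x : T -> nat -> R) (s : seq nat)
    (tau : nat -> R) (al : R) (y : T -> R) :
  (forall p, p \in s -> 0 <= tau p <= 1) ->
  exists2 t, subseq t s &
  al * (size t)%:R + \sum_(i <- I) y i * \prod_(p <- t) x i p <=
  al * \sum_(p <- s) tau p + \sum_(i <- I) y i * \prod_(p <- s) (1 - tau p + tau p * x i p).
Proof.
elim: s y => [|p s IH] y h.
  exists [::] => //; rewrite !big_nil.
  by under eq_bigr do rewrite big_nil; under [in leRHS]eq_bigr do rewrite big_nil.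
have h' q : q \in s -> 0 <= tau q <= 1 by move=> qs; apply: h; rewrite inE qs orbT.
have /andP[t0 t1] := h p (mem_head _ _).
have [t2 st2 le2] := IH y h'.
have [t3 st3 le3] := IH (fun i => y i * x i p) h'.
pose A := al * \sum_(q <- s) tau q.
pose S2 := \sum_(i <- I) y i * \prod_(q <- s) (1 - tau q + tau q * x i q).
pose S3 := \sum_(i <- I) y i * x i p * \prod_(q <- s) (1 - tau q + tau q * x i q).
have E : al * \sum_(q <- p :: s) tau q +
    \sum_(i <- I) y i * \prod_(q <- p :: s) (1 - tau q + tau q * x i q) =
    (1 - tau p) * (A + S2) + tau p * (al + A + S3).
  have -> : \sum_(i <- I) y i * \prod_(q <- p :: s) (1 - tau q + tau q * x i q) =
      (1 - tau p) * S2 + tau p * S3.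
    by rewrite /S2 /S3 !mulr_sumr -big_split /=; apply: eq_bigr => i _; rewrite big_cons; ring.
  by rewrite big_cons /A; ring.
rewrite E; have [le|/ltW le] := lerP (A + S2) (al + A + S3).
  exists t2; first by apply: subseq_trans st2 (subseq_cons _ _).
  by apply: le_trans le2 _; rewrite -/A -/S2; nra.
exists (p :: t3); first by rewrite /= eqxx.
have -> : al * (size (p :: t3))%:R + \sum_(i <- I) y i * \prod_(q <- p :: t3) x i q =
    al + (al * (size t3)%:R + \sum_(i <- I) y i * x i p * \prod_(q <- t3) x i q).
  rewrite /= -natr1 mulrDr mulr1 [RHS]addrA [al + _]addrC; congr (_ + _).
  by apply: eq_bigr => i _; rewrite big_cons mulrA.
apply: (@le_trans _ _ (al + (A + S3))); first by rewrite lerD2l.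
by rewrite addrA; nra.
Qed.

Lemma count_has_le (T U : Type) (a : T -> pred U) (s : seq T) (u : seq U) :
  (count (fun x => has (fun d => a d x) s) u <= \sum_(d <- s) count (a d) u)%N.
Proof.
elim: s => [|d s IH]; first by rewrite big_nil /=; elim: u.
rewrite big_cons; apply: leq_trans (leq_add (leqnn _) IH).
apply: leq_trans (_ : count (predU (a d) (fun x => has (fun d => a d x) s)) u <= _)%N.
  by apply: sub_count.
by rewrite -count_predUI leq_addr.
Qed.

Lemma count_multiples_le (Q d : nat) : (0 < d)%N ->
  (count (fun q => d %| q)%N (index_iota 1 Q.+1))%:R <= Q%:R / d%:R :> R.
Proof.
move=> d0; rewrite -sum1_count.
have -> : (\sum_(1 <= q < Q.+1 | d %| q) 1 = Q %/ d)%N.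
  by rewrite divn_count_dvd big_mkcond; apply: eq_bigr => q _; case: (d %| q)%N.
by rewrite ler_pdivlMr ?ltr0n // -natrM ler_nat leq_trunc_div.
Qed.

End Selection.

Section Core.
Variable R : realType.
Local Notation C := R[i].
Local Notation re := (@complex.Re R).

Lemma hval_le2 d (chi : nat -> C) p : dchar d chi -> 0 <= hval d chi p <= 2.
Proof.
move=> hc; rewrite (le_trans (dist1_ge0 p hc) (hval_ge p hc)) /=.
rewrite /hval; case: ifP => // _.
have := re_dchar_le1 p hc; rewrite ler_norml => /andP[h _]; lra.
Qed.

(** The excluded moduli are the multiples of a [minbad] modulus and the multiples of a chosen prime.
    For any other [q] all nonprincipal characters have [c0 <= Hsum], by [isbad_min]. A single use of
    [select_subset] controls all these characters together with the number of primes, so that [P]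
    serves every [q]. *)
Lemma exists_prime_set (z X Q w : nat) (c0 T : R) :
  (0 < z <= X)%N -> 0 < T -> T <= z%:R -> 0 < c0 -> (0 < Q)%N ->
  \sum_(1 <= d < Q.+1 | `[<minbad z X c0 d>]) d%:R^-1 <= 2 / w%:R :> R ->
  2 * Q%:R ^+ 4 * expR (- (T * c0 / 2)) < 1 ->
  exists P : {fset nat},
  [/\ forall p, p \in P -> prime p /\ (p <= X)%N,
      #|` P |%:R <= 2 * (T * (1 + ln X%:R)) &
      exists E : {fset nat}, #|` E |%:R <= 2 * Q%:R / w%:R + #|` P |%:R * Q%:R / z%:R :> R /\
        forall q, (0 < q <= Q)%N -> q \notin E -> subset_products_mod P q = residue_units q].
Proof.
move=> /andP[z0 zX] T0 Tz c00 Q0 hbad hsmall.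
have z0' : 0 < z%:R :> R by rewrite ltr0n.
have X0 : (0 < X)%N by apply: leq_trans zX.
have lX0 : 0 <= ln X%:R :> R by rewrite ln_ge0 // ler1n.
have Q0' : 0 < Q%:R :> R by rewrite ltr0n.
pose mb d := `[<minbad z X c0 d>].
pose cont q := has (fun d => mb d && (d %| q)%N) (index_iota 1 Q.+1).
pose pr := [seq p <- index_iota z.+1 X.+1 | prime p].
have prP p : p \in pr -> [/\ prime p, (z < p)%N & (p <= X)%N].
  by rewrite mem_filter mem_index_iota ltnS => /and3P[].
pose Kq q (mc : nat * (nat -> nat -> C)) := (0 < q)%N -> let: (m, chi) := mc in
  [/\ (m < q)%N, forall i, (i <= m)%N -> dchar q (chi i),
      forall n, coprime q n -> chi 0%N n = 1,
      forall i, (0 < i <= m)%N -> nonprincipal q (chi i)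
    & forall n, coprime q n -> (n != 1 %[mod q])%N -> \sum_(i < m.+1) chi i n = 0].
have /choice[mc hmc] : forall q, exists mc, Kq q mc.
  move=> q; have [->|q0] := posnP q; first by exists (0%N, fun _ _ => 0).
  by have [m [chi h]] := dual_chars R q0; exists (m, chi).
pose chi q := (mc q).2; pose m q := (mc q).1.
have hm q : (0 < q)%N -> [/\ (m q < q)%N, forall i, (i <= m q)%N -> dchar q (chi q i),
      forall n, coprime q n -> chi q 0%N n = 1,
      forall i, (0 < i <= m q)%N -> nonprincipal q (chi q i)
    & forall n, coprime q n -> (n != 1 %[mod q])%N -> \sum_(i < (m q).+1) chi q i n = 0].
  by move=> /(hmc q); rewrite /chi /m; case: (mc q).
(* [i] starts at [1] to omit the principal character and may stop at [Q] because [m q < q <= Q]. *)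
pose I := [seq qi <- [seq (q, i) | q <- index_iota 1 Q.+1, i <- index_iota 1 Q.+1] |
             ~~ cont qi.1 && (qi.2 <= m qi.1)%N].
have IP q i : (q, i) \in I = [&& (0 < q <= Q)%N, (0 < i <= Q)%N, ~~ cont q & (i <= m q)%N].
  rewrite mem_filter /=; case: (boolP (~~ cont q)) => hq; last by rewrite !andbF.
  rewrite [in RHS]andTb; case: (boolP (i <= m q)%N) => hi; last by rewrite !andbF.
  rewrite !andbT; apply/allpairsP/andP.
    by case=> -[q1 i1] [/=]; rewrite !mem_index_iota !ltnS => h1 h2 [-> ->].
  by case=> h1 h2; exists (q, i); rewrite !mem_index_iota !ltnS.
pose x (qi : nat * nat) p := 1 - hval qi.1 (chi qi.1 qi.2) p / 2.
pose tau (p : nat) : R := T / p%:R.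
have tau01 p : p \in pr -> 0 <= tau p <= 1.
  case/prP=> pp zp _; have p0 : 0 < p%:R :> R by rewrite ltr0n prime_gt0.
  apply/andP; split; first by rewrite divr_ge0 // ltW.
  by rewrite ler_pdivrMr // mul1r (le_trans Tz) // ler_nat ltnW.
(* [b1] bounds the expected number of chosen primes and [b2] the expected sum of the products over
   [I]. With weight [b2 / b1] on the size, the total is at most [2 * b2]; all terms being
   nonnegative, the size is at most [2 * b1] and each product at most [2 * b2]. *)
pose b1 := T * (1 + ln X%:R); pose b2 := Q%:R ^+ 2 * expR (- (T * c0 / 2)).
have b10 : 0 < b1 by rewrite mulr_gt0 // ltr_pwDl.
have b20 : 0 < b2 by rewrite mulr_gt0 ?exprn_gt0 ?expR_gt0.
have [t st ht] := select_subset I x (b2 / b1) (fun _ => 1) tau01.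
have ut : uniq t by apply: subseq_uniq st _; exact/filter_uniq/iota_uniq.
have tP p : p \in t -> [/\ prime p, (z < p)%N & (p <= X)%N] by move/(mem_subseq st)/prP.
have sum_tau : \sum_(p <- pr) tau p <= b1.
  rewrite /b1 /tau -mulr_sumr ler_wpM2l ?(ltW T0) //.
  apply: le_trans (harmonic_le1 R X0).
  rewrite big_filter [leRHS](big_cat_nat (n := z.+1)) //= addrC ler_wpDr //.
    by apply: sumr_ge0 => p _; rewrite invr_ge0.
  by rewrite big_mkcond; apply: ler_sum => p _; case: ifP => // _; rewrite invr_ge0.
have goodH q i : (q, i) \in I -> dchar q (chi q i) /\ c0 <= Hsum z X q (chi q i).
  rewrite IP => /and4P[/andP[q0 qQ] /andP[i0 _] hq im].
  have [_ hd _ hn _] := hm q q0; split; first exact: hd.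
  rewrite leNgt; apply: contra hq => hH.
  have bq : isbad z X c0 q by exists (chi q i); split=> //; [apply: hd|apply: hn; rewrite i0].
  have [d dq md] := isbad_min bq.
  have d0 : (0 < d)%N by apply: dvdn_gt0 dq.
  apply/hasP; exists d; last by rewrite dq andbT; apply/asboolP.
  by rewrite mem_index_iota d0 ltnS (leq_trans (dvdn_leq q0 dq)).
have prodle q i : (q, i) \in I ->
    \prod_(p <- pr) (1 - tau p + tau p * x (q, i) p) <= expR (- (T * c0 / 2)).
  move=> qi; have [hd hH] := goodH q i qi.
  apply: le_trans (_ : \prod_(p <- pr) expR (- (tau p * hval q (chi q i) p / 2)) <= _).
    rewrite big_seq [leRHS]big_seq; apply: ler_prod => p ppr.
    have /andP[t0 t1] := tau01 p ppr; have /andP[h0 h2] := hval_le2 p hd.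
    have -> : 1 - tau p + tau p * x (q, i) p = 1 + - (tau p * hval q (chi q i) p / 2).
      by rewrite /x /=; ring.
    by rewrite expR_ge1Dx andbT; nra.
  rewrite -expR_sum ler_expR sumrN lerN2 -mulr_suml ler_wpM2r //.
  apply: le_trans (ler_wpM2l (ltW T0) hH) _.
  rewrite /Hsum -[index_iota _ _]/(index_iota _ _) mulr_sumr -big_filter.
  by rewrite le_eqVlt; apply/orP; left; apply/eqP; apply: eq_bigr => p _; rewrite /tau; ring.
have sum_prod : \sum_(qi <- I) 1 * \prod_(p <- pr) (1 - tau p + tau p * x qi p) <= b2.
  apply: le_trans (_ : \sum_(qi <- I) expR (- (T * c0 / 2)) <= _).
    by rewrite big_seq [leRHS]big_seq; apply: ler_sum => -[q i] qi; rewrite mul1r prodle.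
  rewrite big_const_seq iter_addr_0 count_predT -[_ *+ size I]mulr_natl ler_wpM2r ?expR_ge0 //.
  rewrite -natrX ler_nat; apply: leq_trans (size_subseq (filter_subseq _ _)) _.
  by rewrite size_allpairs size_iota subn1 mulnn.
have x0 q i p : (q, i) \in I -> 0 <= x (q, i) p.
  by move=> /goodH[hd _]; have := hval_le2 p hd; rewrite /x /=; lra.
have S0 : 0 <= \sum_(qi <- I) 1 * \prod_(p <- t) x qi p.
  rewrite big_seq; apply: sumr_ge0 => -[q i] qi; rewrite mul1r; apply: prodr_ge0 => p _.
  exact: x0.
have ht2 : b2 / b1 * (size t)%:R + \sum_(qi <- I) 1 * \prod_(p <- t) x qi p <= 2 * b2.
  apply: le_trans ht _; rewrite mulr2n mulrDl mul1r lerD //.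
  apply: le_trans (ler_wpM2l (ltW (divr_gt0 b20 b10)) sum_tau) _.
  by rewrite divfK // gt_eqF.
have size_t : (size t)%:R <= 2 * b1.
  have : b2 / b1 * (size t)%:R <= b2 / b1 * (2 * b1).
    have -> : b2 / b1 * (2 * b1) = 2 * b2 by field; rewrite gt_eqF.
    by apply: le_trans ht2; rewrite lerDl.
  by rewrite ler_pM2l // divr_gt0.
have each q i : (q, i) \in I -> \prod_(p <- t) x (q, i) p <= 2 * b2.
  move=> qi; apply: le_trans ht2.
  apply: ler_wpDl; first by rewrite mulr_ge0 // ltW // divr_gt0.
  rewrite (big_rem (q, i)) //= mul1r lerDl big_seq; apply: sumr_ge0 => -[q1 i1] qi1.
  by rewrite mul1r; apply: prodr_ge0 => p _; apply: x0; apply: mem_rem qi1.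
pose P : {fset nat} := [fset p in t].
have PE p : (p \in P) = (p \in t) by rewrite inE.
have Pperm : perm_eq P t.
  by apply: uniq_perm; [exact: fset_uniq|exact: ut|exact: PE].
have cardP : #|` P | = size t by rewrite (perm_size Pperm).
pose badq q := cont q || has (fun p => p %| q)%N t.
pose E : {fset nat} := [fset q in [seq q <- index_iota 1 Q.+1 | badq q]].
exists P; split.
- by move=> p; rewrite PE => /tP[].
- by rewrite cardP.
exists E; split; last first.
  move=> q /andP[q0 qQ] qE.
  have nb : ~~ badq q by move: qE; rewrite inE mem_filter mem_index_iota q0 ltnS qQ !andbT.
  have [nc nt] : ~~ cont q /\ ~~ has (fun p => p %| q)%N t by apply/andP; rewrite -negb_or.
  have [mq hd h0 hn hs] := hm q q0.
  apply: (@subset_products_units R P q (m q) (chi q) (2 * b2)) => //.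
  - move=> p; rewrite PE => pt; have [pp _ _] := tP p pt; split=> //.
    exact: (hasPn nt) p pt.
  - move=> i /andP[i0 im]; rewrite (perm_big _ Pperm) /=.
    by apply: (each q i); rewrite IP q0 qQ i0 nc im (leq_trans im) // (leq_trans (ltnW mq)).
  apply: le_lt_trans hsmall; rewrite /b2.
  have -> : 2 * Q%:R ^+ 4 * expR (- (T * c0 / 2)) =
     2 * (Q%:R ^+ 2 * expR (- (T * c0 / 2))) * Q%:R ^+ 2 by ring.
  rewrite ler_wpM2l ?mulr_ge0 ?exprn_ge0 ?expR_ge0 //.
  by rewrite lerXn2r ?nnegrE // ler_nat.
rewrite cardP.
have -> : #|` E | = count badq (index_iota 1 Q.+1).
  rewrite -size_filter; apply/perm_size/uniq_perm; rewrite ?fset_uniq //.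
    exact/filter_uniq/iota_uniq.
  by move=> q; rewrite inE.
apply: le_trans (_ : (count cont (index_iota 1 Q.+1))%:R +
   (count (fun q => has (fun p => p %| q)%N t) (index_iota 1 Q.+1))%:R <= _).
  by rewrite -natrD ler_nat -count_predUI leq_addr.
apply: lerD.
  apply: le_trans (_ : (\sum_(d <- index_iota 1 Q.+1)
     count (fun q => mb d && (d %| q)%N) (index_iota 1 Q.+1))%:R <= _).
    by rewrite ler_nat count_has_le.
  have -> : 2 * Q%:R / w%:R = Q%:R * (2 / w%:R) :> R by ring.
  apply: le_trans (ler_wpM2l (ltW Q0') hbad); rewrite natr_sum mulr_sumr [leRHS]big_mkcond.
  rewrite big_nat [leRHS]big_nat; apply: ler_sum => d /andP[d0 _]; rewrite -/(mb d).
  case: ifP => md; last by rewrite count_pred0.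
  exact: count_multiples_le.
apply: le_trans (_ : (\sum_(p <- t) count (fun q => p %| q)%N (index_iota 1 Q.+1))%:R <= _).
  by rewrite ler_nat count_has_le.
rewrite natr_sum.
have -> : (size t)%:R * Q%:R / z%:R = \sum_(p <- t) Q%:R / z%:R :> R.
  by rewrite big_const_seq iter_addr_0 count_predT -mulrA mulr_natl.
rewrite big_seq [leRHS]big_seq; apply: ler_sum => p /tP[pp zp _].
have p0 := prime_gt0 pp.
apply: le_trans (count_multiples_le R Q p0) _.
by rewrite ler_wpM2l ?(ltW Q0') // lef_pV2 ?posrE ?ltr0n // ler_nat ltnW.
Qed.

End Core.

(** * Bounds for exponentials and logarithms *)

Section Asymptotics.
Variable R : realType.

(** From [exp (- 1 / 6) >= 5 / 6], since [(6 / 5) ^ 6 < 3]; with fifths the same argument exceeds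
    [3]. *)
Lemma expR1_le3 : expR 1 <= 3 :> R.
Proof.
have h : expR (1 / 6) <= 6 / 5 :> R.
  have := @expR_ge1Dx R (- (1 / 6)); rewrite expRN => h.
  have e0 := @expR_gt0 R (1 / 6).
  rewrite -[leLHS]invrK -[6 / 5]invrK lef_pV2 ?posrE ?invr_gt0 ?divr_gt0 //.
  by apply: le_trans h; rewrite invf_div; lra.
have -> : expR 1 = expR (1 / 6) ^+ 6 :> R.
  by rewrite -expRM_natl; congr expR; field.
apply: le_trans (_ : (6 / 5) ^+ 6 <= _); last by lra.
by rewrite lerXn2r ?nnegrE ?expR_ge0 // divr_ge0.
Qed.

Lemma ln_ge1 (Q : R) : 3 <= Q -> 1 <= ln Q.
Proof.
move=> Q3; rewrite -[leLHS]expRK ler_ln ?posrE ?expR_gt0 //; last by lra.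
exact: le_trans expR1_le3 Q3.
Qed.

Lemma ln_le_powR (s x : R) : 0 < s -> 0 < x -> ln x <= s^-1 * x `^ s.
Proof.
move=> s0 x0; rewrite ler_pdivlMl // -ln_powR.
by apply: ltW; apply: ln_sublinear; apply: powR_gt0.
Qed.

(** [ln L] is at most [4 / eps] times [L ^ (eps / 4)], so the square takes half of the exponent
    [eps], and the other half absorbs [D * F ^ 2] for large [L]. *)
Lemma polylog_bound (eps D E : R) : 0 < eps -> 0 < D -> 0 < E ->
  exists2 L0 : R, 1 < L0 & forall L : R, L0 <= L -> D * (1 + E * ln L) ^+ 2 <= L `^ eps.
Proof.
move=> e0 D0 E0; pose F := 1 + E * (eps / 4)^-1.
have F0 : 0 < F by rewrite ltr_pwDl // mulr_ge0 ?invr_ge0 ?divr_ge0 // ltW.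
exists (2 + (D * F ^+ 2) `^ (2 / eps)); first by have := powR_ge0 (D * F ^+ 2) (2 / eps); lra.
move=> L hL; have g0 := powR_ge0 (D * F ^+ 2) (2 / eps).
have L1 : 1 <= L by lra.
have L0 : 0 < L by lra.
have s0 : 0 < eps / 4 by rewrite divr_gt0.
have h1 := ln_le_powR s0 L0.
have p1 : 1 <= L `^ (eps / 4).
  by rewrite -[leLHS](powRr0 L) ler_powR // ltW.
have h2 : 1 + E * ln L <= F * L `^ (eps / 4).
  apply: (@le_trans _ _ (L `^ (eps / 4) + E * ((eps / 4)^-1 * L `^ (eps / 4)))).
    by rewrite lerD // ler_wpM2l // ltW.
  by rewrite /F le_eqVlt; apply/orP; left; apply/eqP; ring.
have l0 : 0 <= 1 + E * ln L by rewrite addr_ge0 // mulr_ge0 ?ln_ge0 // ltW.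
have h3 : (1 + E * ln L) ^+ 2 <= F ^+ 2 * L `^ (eps / 2).
  have -> : L `^ (eps / 2) = L `^ (eps / 4) ^+ 2.
    by rewrite -powR_mulrn ?powR_ge0 // -powRrM; congr (_ `^ _); field.
  by rewrite -exprMn lerXn2r ?nnegrE // mulr_ge0 ?powR_ge0 // ltW.
have h4 : D * F ^+ 2 <= L `^ (eps / 2).
  have DF : 0 <= D * F ^+ 2 by rewrite mulr_ge0 ?exprn_ge0 // ltW.
  have -> : D * F ^+ 2 = ((D * F ^+ 2) `^ (2 / eps)) `^ (eps / 2).
    rewrite -powRrM; have -> : 2 / eps * (eps / 2) = 1 by field; rewrite gt_eqF.
    by rewrite powRr1.
  apply: ge0_ler_powR; first by rewrite divr_ge0 // ltW.
  - by rewrite nnegrE.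
  - by rewrite nnegrE ltW.
  lra.
have -> : L `^ eps = L `^ (eps / 2) * L `^ (eps / 2).
  rewrite -powRD; first by congr (_ `^ _); field.
  by rewrite (gt_eqF L0) implybT.
apply: le_trans (ler_wpM2l (ltW D0) h3) _.
by rewrite mulrA ler_wpM2r ?powR_ge0.
Qed.

End Asymptotics.

(** * Choice of the parameters *)

Section Assembly.
Variable R : realType.

Lemma param_bounds (a b B l : nat) :
  (256 <= b)%N -> (4 * b + 6 <= B)%N -> (24 <= a)%N -> (512 <= l)%N ->
  [/\ (l * l <= l ^ (2 * a))%N, (2 < l ^ (2 * a))%N, (0 < B)%N, (32 <= 2 * a)%N &
     (l ^ (2 * a) * l ^ (2 * a) <= (l ^ (2 * a)) ^ B)%N].
Proof.
move=> hb hB ha hl; have l0 : (0 < l)%N by apply: leq_trans hl.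
have h1 : (l * l <= l ^ (2 * a))%N by rewrite mulnn leq_pexp2l //; lia.
split=> //; [by apply: leq_trans h1; nia|lia|lia|].
by rewrite mulnn leq_pexp2l ?expn_gt0 ?l0 //; lia.
Qed.

(** Discarding the primes up to [z] costs [8 * lam * z], at most half of [X], so Chebyshev's bound
    survives with twice the constant. *)
Lemma prime_count_bound (z X Pi PX lam l : nat) : (512 * lam <= l)%N -> (512 <= l)%N ->
  (l * l <= z)%N -> (z * z <= X)%N -> (PX <= z + Pi)%N ->
  (X <= 8 * lam * PX)%N -> (X <= 16 * lam * Pi)%N.
Proof.
move=> h1 h2 h3 h4 h5 h6.
have h7 : (16 * lam * z <= X)%N.
  by apply: leq_trans h4; rewrite leq_mul2r; apply/orP; right; nia.
have := leq_mul (leqnn (8 * lam)%N) h5; nia.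
Qed.

(* The parameters: [l >= ln Q], [z = l ^ (2 a)], [X = z ^ B], [u = 1 + ln X]. *)
Lemma exists_prime_set_large (a b B l : nat) (Q : R) :
  (256 <= b)%N -> (4 * b + 6 <= B)%N -> (24 <= a)%N -> 3 <= Q ->
  ln Q <= l%:R ->
  let X := ((l ^ (2 * a)) ^ B)%N in
  let u := 1 + ln X%:R : R in
  let kap := (2 ^+ (B + 6) * 4 ^+ B : R) in
  512 * u <= l%:R -> 12 * kap * u <= l%:R ->
  exists P : {fset nat},
  [/\ forall p, p \in P -> prime p /\ (p <= X)%N,
      #|` P |%:R <= 24 * kap * ln Q * u ^+ 2 &
      exists E : {fset nat},
        #|` E |%:R <= 2 * Q / (l ^ a)%:R + #|` P |%:R * Q / (l ^ (2 * a))%:R :> R /\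
        forall q, (0 < q)%N -> q%:R <= Q -> q \notin E ->
          subset_products_mod P q = residue_units q].
Proof.
move=> b256 bB a24 Q3 Ql X u kap hu1 hu2.
set z := (l ^ (2 * a))%N in X u hu1 hu2 *; set w := (l ^ a)%N.
have L1 := ln_ge1 Q3; have Q0 : 0 < Q by lra.
have l0 : (0 < l)%N by rewrite -(ltr0n R); lra.
have X0 : (0 < X)%N by rewrite !expn_gt0 l0.
have X0' : 0 < X%:R :> R by rewrite ltr0n.
have lX0 : 0 <= ln X%:R :> R by rewrite ln_ge0 // ler1n.
have u1 : 1 <= u by rewrite lerDl.
(* An integer between [ln X] and [u], for the counting arguments in [nat]. *)
pose lam := (Num.trunc (ln X%:R : R)).+1.
have lam_gt : ln X%:R <= lam%:R :> R by rewrite ltW // truncnS_gt.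
have lam_le : lam%:R <= u.
  by rewrite /lam -natr1 addrC lerD2l truncn_le.
have laml : (512 * lam <= l)%N.
  rewrite -(ler_nat R) natrM; apply: le_trans hu1.
  apply: ler_wpM2l lam_le.
  exact: ler0n.
have l512 : (512 <= l)%N by apply: leq_trans laml; rewrite leq_pmulr.
have [lz z3 B0 a32 zzX] := param_bounds b256 bB a24 l512; rewrite -/z in lz z3 zzX.
have z0 : (0 < z)%N by apply: leq_trans z3.
have zX : (z <= X)%N by apply: leq_trans zzX; rewrite leq_pmulr.
have ww : (w ^ 2 = z)%N by rewrite /w /z -expnM mulnC.
pose Pi := size [seq p <- index_iota z.+1 X.+1 | prime p].
have XPi : (X <= 16 * lam * Pi)%N.
  have X1 : (1 < X)%N by apply: leq_trans zX; apply: ltnW.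
  have h1 := size_primes_le_ge R X1.
  have h2 : (size (primes_le X) <= z + Pi)%N.
    rewrite /primes_le /index_iota subn1 /=.
    rewrite -[X](subnKC zX) iotaD filter_cat size_cat leq_add //.
      by rewrite (leq_trans (size_subseq (filter_subseq _ _))) // size_iota.
  apply: (prime_count_bound laml l512 lz zzX h2).
  rewrite -(ler_nat R) !natrM; apply: le_trans h1 _.
  by apply: ler_wpM2r => //; apply: ler_wpM2l.
have kap0 : 0 < kap by rewrite mulr_gt0 ?exprn_gt0.
have kap64 : 64 <= kap.
  rewrite /kap addnC exprD -mulrA -[leLHS]mulr1.
  have -> : 2 ^+ 6 = 64 :> R by ring.
  by rewrite ler_pM2l // mulr_ege1 ?exprn_ege1 ?ler1n.
have ku0 : 0 < kap * u by rewrite mulr_gt0 //; lra.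
(* The reciprocal of the constant in [Hsum_small], so that no modulus up to [z] is bad; [kap >= 64]
   then yields [X * c0 <= Pi / 2]. *)
pose c0 := (kap * u)^-1.
have c00 : 0 < c0 by rewrite invr_gt0.
have Xc0 : X%:R * c0 <= Pi%:R / 2.
  rewrite /c0 ler_pdivrMr //.
  apply: le_trans (_ : (16 * lam * Pi)%:R <= _); first by rewrite ler_nat.
  rewrite !natrM.
  have hh : 32 * lam%:R <= kap * u by apply: ler_pM => //; lra.
  have := ler_wpM2l (ler0n R Pi) hh; lra.
have hsmall d : isbad z X c0 d -> (z < d)%N.
  case=> chi [hc hn hH]; rewrite ltnNge; apply/negP => dz.
  have := Hsum_small hc hn dz z3 b256 bB; rewrite -/X -/kap -/u => h.
  have : kap * u * Hsum z X d chi < kap * u * c0 by rewrite ltr_pM2l.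
  by rewrite /c0 divff ?gt_eqF // => /(le_lt_trans h); rewrite ltxx.
pose N := Num.trunc Q.
have N0 : (0 < N)%N by rewrite truncn_gt0; lra.
have NQ : N%:R <= Q by rewrite truncn_le ltW.
have N3 : (N <= 3 ^ l)%N.
  rewrite -(ler_nat R) natrX; apply: le_trans NQ _.
  rewrite -[Q]lnK ?posrE //; apply: le_trans (_ : expR l%:R <= _); first by rewrite ler_expR.
  rewrite -[l%:R]mulr1 expRM_natl lerXn2r ?nnegrE ?expR_ge0 //.
  exact: expR1_le3.
have w0 : (0 < w)%N by rewrite expn_gt0 l0.
have hbad := sum_minbad (isT : (0 < lam)%N) laml a32 B0 XPi Xc0 N3 w0 (eq_leq ww) hsmall.
(* This makes [exp (- T * c0 / 2)] equal to [Q ^ (- 6)], enough against [2 * Q ^ 4] because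
   [Q ^ 2 > 2]. *)
pose T := 12 * ln Q / c0.
have TE : T = 12 * ln Q * (kap * u) by rewrite /T /c0 invrK.
have T0 : 0 < T by rewrite TE mulr_gt0 //; lra.
have Tz : T <= z%:R.
  apply: le_trans (_ : l%:R * l%:R <= _); last by rewrite -natrM ler_nat.
  have -> : T = ln Q * (12 * kap * u) by rewrite TE; ring.
  by apply: ler_pM => //; [lra|rewrite !mulr_ge0 //; lra].
have hexp : 2 * N%:R ^+ 4 * expR (- (T * c0 / 2)) < 1.
  have -> : T * c0 / 2 = 6%:R * ln Q by rewrite /T; field; rewrite gt_eqF.
  rewrite expRN expRM_natl lnK ?posrE // ltr_pdivrMr ?exprn_gt0 // mul1r.
  apply: le_lt_trans (_ : 2 * Q ^+ 4 < _).
    by rewrite ler_wpM2l // lerXn2r ?nnegrE // ltW.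
  have -> : Q ^+ 6 = Q ^+ 2 * Q ^+ 4 by ring.
  by rewrite ltr_pM2r ?exprn_gt0 //; nra.
have := exists_prime_set (z := z) (X := X) _ T0 Tz c00 N0 hbad hexp.
rewrite z0 zX => /(_ isT)[P [P1 P2 [E [E1 E2]]]].
exists P; split=> //.
  apply: le_trans P2 _; rewrite TE -/u le_eqVlt; apply/orP; left; apply/eqP; ring.
exists E; split.
  apply: le_trans E1 _; rewrite lerD // ler_wpM2r ?invr_ge0 // ler_wpM2l //.
by move=> q q0 qQ; apply: E2; rewrite q0 truncn_ge_nat // ltW.
Qed.

End Assembly.

(** * Final choice of the constants and of the exceptional set *)

Theorem theorem1p1 (R : realType) :
  exists C : R, 1 <= C /\
  forall eps A : R, 0 < eps < 1 -> 0 < A ->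
  exists K : R, 0 < K /\
  forall Q : R, 3 <= Q ->
  exists P : {fset nat},
    [/\ (forall p : nat, p \in P ->
           prime p /\ 1 <= (p%:R : R) <= ln Q `^ (C * (A + 1))),
        #|` P |%:R <= ln Q `^ (1 + eps)
      & exists E : {fset nat},
          #|` E |%:R <= K * (Q * ln Q `^ (- A)) /\
          forall q : nat, (0 < q)%N -> q%:R <= Q -> q \notin E ->
            subset_products_mod P q = residue_units q].
Proof.
(* These are the least values the sieve admits; they depend on neither [eps] nor [A]. Behind the
   existential, powers such as [2 ^+ (B + 6)] stay symbolic. *)
have [b [B [b256 bB]]] : exists b B, (256 <= b)%N /\ (4 * b + 6 <= B)%N.
  by exists 256%N, (4 * 256 + 6)%N.
have B1 : 1 <= B%:R :> R by rewrite ler1n; lia.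
(* The primes are at most [X = l ^ (2 * a * B)], hence at most [L ^ (4 * a * B)] as [l <= L ^ 2],
   and [a <= 25 * (A + 1)]. *)
exists (100 * B%:R); split; first by lra.
move=> eps A /andP[eps0 eps1] A0.
pose a := (Num.trunc A + 25)%N.
have a24 : (24 <= a)%N by rewrite /a; lia.
have aA : A <= a%:R.
  by have := truncnS_gt A; rewrite /a natrD -natr1; lra.
have aA1 : a%:R <= 25 * (A + 1).
  have : (Num.trunc A)%:R <= A by rewrite truncn_le ltW.
  by rewrite /a natrD; lra.
pose kap : R := 2 ^+ (B + 6) * 4 ^+ B.
have kap0 : 0 < kap by rewrite mulr_gt0 ?exprn_gt0.
pose EE : R := 4 * a%:R * B%:R.
have EE0 : 0 < EE by rewrite !mulr_gt0 //; lra.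
(* This one constant covers three demands: [512 * u <= l] and [12 * kap * u <= l], through
   [L ^ eps <= L <= l], and the bound [24 * kap * L * u ^ 2] for the size of [P]. Here
   [u <= 1 + EE * ln L]. *)
have D0 : 0 < 512 + 24 * kap by lra.
have [L0 L01 hL0] := polylog_bound eps0 D0 EE0.
pose L1 := 2 + L0.
have K0 := powR_ge0 L1 A.
exists (3 + L1 `^ A); split; first by lra.
move=> Q Q3; set L := ln Q; have L_ge1 : 1 <= L := ln_ge1 Q3.
have Q0 : 0 < Q by lra.
have Lp : 0 < L by lra.
have LA0 : 0 < L `^ A by rewrite powR_gt0.
have [Lsmall|Llarge] := lerP L L1.
  (* For bounded [L] the set of primes is empty and all [q <= Q] are exceptional; the summand
     [L1 ^ A] of [K] pays for this. *)
  exists fset0; split=> //; first by rewrite cardfs0 powR_ge0.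
  exists [fset q in index_iota 1 (Num.trunc Q).+1]; split; last first.
    move=> q q0 qQ; rewrite inE mem_index_iota q0 ltnS /=.
    by rewrite truncn_ge_nat ?qQ // ltW.
  have -> : #|` [fset q in index_iota 1 (Num.trunc Q).+1]| = Num.trunc Q.
    rewrite -[RHS](_ : size (index_iota 1 (Num.trunc Q).+1) = _); last by rewrite size_iota subn1.
    apply/perm_size/uniq_perm; [exact: fset_uniq|exact: iota_uniq|].
    by move=> q; rewrite inE.
  apply: (@le_trans _ _ Q); first by rewrite truncn_le ltW.
  rewrite powRN mulrCA ler_peMr ?(ltW Q0) // ler_pdivlMr // mul1r.
  apply: (@le_trans _ _ (L1 `^ A)); last by rewrite lerDr.
  by apply: ge0_ler_powR; rewrite ?nnegrE //; [exact: ltW|exact: ltW|rewrite /L1; lra].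
pose l := (Num.trunc L).+1.
have Ll : L <= l%:R by rewrite ltW // truncnS_gt.
have lL : l%:R <= L + 1 by rewrite /l -natr1 lerD2r truncn_le ltW.
have L2 : 2 <= L by rewrite /L1 in Llarge; lra.
have lLL : l%:R <= L ^+ 2 by rewrite expr2; nra.
have l0 : 0 < l%:R :> R by rewrite ltr0n.
have LL0 : L0 <= L by rewrite /L1 in Llarge; lra.
set U := 1 + EE * ln L; have hU : (512 + 24 * kap) * U ^+ 2 <= L `^ eps := hL0 L LL0.
have lnL0 : 0 <= ln L by rewrite ln_ge0.
have U1 : 1 <= U by rewrite lerDl mulr_ge0 // ltW.
have U2 : U <= U ^+ 2 by rewrite expr2 ler_peMr //; lra.
have Leps : L `^ eps <= l%:R.
  by apply: le_trans Ll; rewrite -[leRHS](@powRr1 _ L) ?ler_powR // ltW.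
set X := ((l ^ (2 * a)) ^ B)%N.
have XE : X%:R = l%:R ^+ (2 * a * B) :> R by rewrite /X -expnM natrX.
have lnX : ln X%:R <= EE * ln L :> R.
  rewrite XE lnXn // -[_ *+ (2 * a * B)]mulr_natl /EE.
  have : ln l%:R <= ln (L ^+ 2) by rewrite ler_ln ?posrE ?exprn_gt0.
  rewrite lnXn // -[ln L *+ 2]mulr_natl => h.
  have := ler_wpM2l (ler0n R (2 * a * B)) h; rewrite !natrM; lra.
have uU : 1 + ln X%:R <= U by rewrite lerD2l.
have ab : 0 <= ln X%:R :> R by rewrite ln_ge0 // ler1n !expn_gt0.
have uU2 : (1 + ln X%:R) ^+ 2 <= U ^+ 2 by rewrite lerXn2r ?nnegrE //; lra.
have kU : 0 <= kap * U by rewrite mulr_ge0 //; lra.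
have kU2 : kap * U <= kap * U ^+ 2 by rewrite ler_wpM2l // ltW.
have c1 : 512 * (1 + ln X%:R) <= l%:R :> R.
  by apply: le_trans Leps; apply: le_trans hU; nra.
have c2 : 12 * kap * (1 + ln X%:R) <= l%:R :> R.
  apply: le_trans Leps; apply: le_trans hU.
  have : kap * (1 + ln X%:R) <= kap * U by rewrite ler_wpM2l // ltW.
  by nra.
have [P [P1 P2 [E [E1 E2]]]] := exists_prime_set_large b256 bB a24 Q3 Ll c1 c2.
rewrite -/X -/kap -/L in P1 P2 E1.
have P3 : #|` P |%:R <= L `^ (1 + eps).
  apply: le_trans P2 _; rewrite powRD; last by rewrite (gt_eqF Lp) implybT.
  rewrite powRr1 ?(ltW Lp) //.
  apply: (@le_trans _ _ (L * ((512 + 24 * kap) * U ^+ 2))); last by rewrite ler_wpM2l // ltW.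
  have -> : 24 * kap * L * (1 + ln X%:R) ^+ 2 = L * (24 * kap * (1 + ln X%:R) ^+ 2) by ring.
  rewrite ler_wpM2l ?(ltW Lp) //; apply: ler_pM => //.
  - by rewrite mulr_ge0 // ltW.
  - by rewrite exprn_ge0 //; lra.
  by rewrite lerDr; exact: ler0n.
exists P; split=> //.
  move=> p pP; have [pp pX] := P1 p pP; split=> //.
  rewrite ler1n prime_gt0 //=.
  apply: (@le_trans _ _ X%:R); first by rewrite ler_nat.
  rewrite XE; apply: (@le_trans _ _ (L ^+ (2 * (2 * a * B)))).
    by rewrite [in leRHS]exprM lerXn2r ?nnegrE ?exprn_ge0 ?(ltW Lp).
  rewrite -powR_mulrn ?(ltW Lp) // ler_powR // !natrM.
  have : a%:R * B%:R <= 25 * (A + 1) * B%:R by rewrite ler_wpM2r.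
  lra.
exists E; split=> //; apply: le_trans E1 _.
have lw : L `^ A <= (l ^ a)%:R.
  rewrite natrX -powR_mulrn ?(ltW l0) //; apply: (@le_trans _ _ (L `^ a%:R)).
    by rewrite ler_powR.
  by apply: ge0_ler_powR; rewrite ?nnegrE // ltW.
have w0 : 0 < (l ^ a)%:R :> R by rewrite ltr0n expn_gt0.
(* By [L ^ (1 + eps) <= L ^ 2 <= l ^ 2 <= l ^ a], the multiples of primes of [P] cost at most
   [Q / l ^ a]. Together with [2 * Q / l ^ a] this accounts for the summand [3] of [K]. *)
have Pl : #|` P |%:R <= (l ^ a)%:R :> R.
  apply: le_trans P3 _; apply: (@le_trans _ _ (L `^ 2%:R)); first by rewrite ler_powR //; lra.
  rewrite powR_mulrn ?(ltW Lp) //; apply: (@le_trans _ _ (l%:R ^+ 2)).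
    by rewrite lerXn2r ?nnegrE // ltW.
  by rewrite -natrX ler_nat leq_pexp2l // (leq_trans _ a24).
have QL : Q / (l ^ a)%:R <= Q * L `^ (- A).
  by rewrite powRN ler_wpM2l ?(ltW Q0) // lef_pV2 ?posrE.
have PQ : #|` P |%:R * Q / (l ^ (2 * a))%:R <= Q / (l ^ a)%:R.
  rewrite mul2n -addnn expnD natrM ler_pdivrMr ?mulr_gt0 //.
  have -> : Q / (l ^ a)%:R * ((l ^ a)%:R * (l ^ a)%:R) = (l ^ a)%:R * Q.
    by field; rewrite gt_eqF.
  by rewrite ler_wpM2r // ltW.
have QA0 : 0 <= Q * L `^ (- A) by rewrite mulr_ge0 ?powR_ge0 // ltW.
have : 0 <= L1 `^ A * (Q * L `^ (- A)) by rewrite mulr_ge0.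
have -> : 2 * Q / (l ^ a)%:R = 2 * (Q / (l ^ a)%:R) by rewrite mulrA.
rewrite mulrDl; move: QL PQ; lra.
Qed.
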